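(* For every $n>0$, the $F$-triangle $F_n(x,y)$ associated with the Hochschild lattice $\mathrm{Hoch}(n)$ satisfies $$F_n(x,y)=\sum_{u\in\mathrm{Tri}(n)}x^{\,n-|\mathrm{Can}(u)|}(x+1)^{|\mathrm{Can}(u)|-\mathrm{neg}(u)}(y+1)^{\mathrm{neg}(u)}.$$
   Context: Hochschild lattice. For $n\geq 1$, a triword of length $n$ is a tuple $u=(u_1,\ldots,u_n)$ such that (T1) $u_i\in\{0,1,2\}$ for all $i$; (T2) $u_1\neq 2$; (T3) if $u_i=0$, then $u_j\neq 1$ for all $j>i$. Let $\mathrm{Tri}(n)$ be the set of all triwords of length $n$. The Hochschild lattice is $\mathrm{Hoch}(n)=(\mathrm{Tri}(n),\leq)$ where $\leq$ is the componentwise order. It is known to be a semidistributive lattice: the join is the componentwise maximum, and the meet is obtained by taking the componentwise minimum and then replacing by $0$ every entry $1$ that has an entry $0$ somewhere to its left. Labels, canonical join representations, core label order. Let $L$ be a finite semidistributive lattice. For a cover relation $a\lessdot b$ put $\lambda(a,b)=\min\{c\in L\mid a\vee c=b\}$; this minimum exists and is join irreducible. The canonical join representation of $a\in L$ is $\mathrm{Can}(a)=\{\lambda(b,a)\mid b\lessdot a\}$ (equivalently, the antichain with join $a$ that refines every subset with join $a$). The nucleus of $a$ is $a_\downarrow=a\wedge\bigwedge_{b\lessdot a}b$. The core label set of $a$ is $\Psi(a)=\{\lambda(b,b')\mid a_\downarrow\leq b\lessdot b'\leq a\}$. The map $a\mapsto\Psi(a)$ is injective. The core label order $\mathrm{CLO}(L)$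 is the poset $(L,\sqsubseteq)$ where $a\sqsubseteq b$ if and only if $\Psi(a)\subseteq\Psi(b)$. $F$-triangle. The poset $\mathrm{CLO}(\mathrm{Hoch}(n))$ is graded with least element $(0,\ldots,0)$; let $\mathrm{rk}$ be its rank function (so $\mathrm{rk}(0,\ldots,0)=0$) and $\mu_n$ its Möbius function (with $\mu_n(u,v)=0$ if $u\not\sqsubseteq v$). Define $$M_n(x,y)=\sum_{u,v\in\mathrm{Tri}(n)}\mu_n(u,v)\,x^{\mathrm{rk}(u)}y^{\mathrm{rk}(v)},\qquad F_n(x,y)=y^n M_n\left(\frac{y+1}{y-x},\frac{y-x}{y}\right).$$ Atoms. Let $\mathrm{Atom}(n)$ be the set of atoms of $\mathrm{Hoch}(n)$, i.e. of elements covering $(0,\ldots,0)$. Explicitly, these are $(1,0,\ldots,0)$ and, for $2\leq i\leq n$, the tuple with a $2$ in position $i$ and zeros elsewhere. For $u\in\mathrm{Tri}(n)$ let $\mathrm{neg}(u)=|\mathrm{Can}(u)\cap\mathrm{Atom}(n)|$, where $\mathrm{Can}(u)$ is taken in $\mathrm{Hoch}(n)$. *)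

(* Defs.v *)
From HB Require Import structures.
From mathcomp Require Import all_boot all_order all_algebra.
From mathcomp Require Import mpoly.

Set Implicit Arguments.
Unset Strict Implicit.
Unset Printing Implicit Defensive.

Import Order.TTheory GRing.Theory.

Section FinPOrder.
Context (d : Order.disp_t) (P : finPOrderType d).
Implicit Types (x y z : P) (C : {set P}).
Local Open Scope order_scope.

Definition covers x y : bool := (x < y) && [forall z, ~~ (x < z < y)].

Definition chain C : bool := [forall x in C, forall y in C, x >=< y].

(* The length of a longest chain with top at most x.  If P is graded with a
   least element, this is its rank function: see [rankP] below. *)
Definition rank x : nat :=
  \max_(C : {set P} | chain C && [forall y in C, y <= x]) #|C|.-1.

(* The first argument is a recursion bound; #|P| is large enough, see
   [mobiusE] below. *)
Fixpoint mobius_rec (k : nat) x y : int :=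
  if x == y then 1%R
  else if k is k'.+1 then (- \sum_(z : P | (x <= z < y)%O) mobius_rec k' x z)%R
  else 0%R.

Definition mobius : P -> P -> int := mobius_rec #|P|.

Lemma mobiusE x y :
  mobius x y =
    if x == y then 1%R else (- \sum_(z : P | (x <= z < y)%O) mobius x z)%R.
Proof.
pose below (z : P) := [set t : P | x <= t < z].
have below_lt z t : x <= z < t -> (#|below z| < #|below t|)%N.
  case/andP=> xz zt; apply: proper_card; apply/properP; split.
    apply/subsetP => s; rewrite !inE => /andP[-> sz] /=.
    exact: lt_trans sz zt.
  by exists z; rewrite !inE ?xz ?zt ?ltxx ?andbF.
have stable k l z : (#|below z| <= k)%N -> (#|below z| <= l)%N ->
    mobius_rec k x z = mobius_rec l x z.
  elim: k l z => [|k IH] l z.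
    rewrite leqn0 => /eqP z0 _.
    have E (t : P) : (x <= t < z) = false.
      by apply/negP => /below_lt; rewrite z0.
    case: l => [//|l] /=; case: ifP => // _.
    by rewrite big_pred0 ?oppr0 // => t; exact: E.
  case: l => [|l] zk zl.
    move: zl; rewrite leqn0 => /eqP z0.
    have E (t : P) : (x <= t < z) = false.
      by apply/negP => /below_lt; rewrite z0.
    rewrite /=; case: ifP => // _.
    by rewrite big_pred0 ?oppr0 // => t; exact: E.
  rewrite /=; case: ifP => // _; congr (- _)%R; apply: eq_bigr => t /below_lt lt.
  by apply: IH; rewrite -ltnS; apply: (leq_trans lt).
have bP : (#|below y| <= #|P|)%N by exact: max_card.
by have -> : mobius x y = mobius_rec #|P|.+1 x y by apply: stable; rewrite ?leqW.
Qed.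

Definition is_rank_function (r : P -> nat) : Prop :=
  (forall x, (forall y, ~~ (y < x)) -> r x = 0%N)
  /\ (forall x y, covers x y -> r y = (r x).+1).

Lemma ex_lower_cover x y : x < y -> exists2 z, x <= z & covers z y.
Proof.
move=> xy; pose D z := [set t : P | z < t < y].
have xP : [pred z | x <= z < y] x by rewrite /= lexx.
case: (arg_minnP (fun z => #|D z|) xP) => z /andP[xz zy] zmin.
exists z => //; rewrite /covers zy /=; apply/forallP => t; apply/negP.
case/andP=> zt ty.
have := zmin t; rewrite /= ty (le_trans xz (ltW zt)) /= => /(_ isT).
rewrite leqNgt => /negP; apply; apply: proper_card; apply/properP; split.
  by apply/subsetP => s; rewrite !inE => /andP[ts ->]; rewrite (lt_trans zt ts).
by exists t; rewrite !inE ?zt ?ty ?ltxx.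
Qed.

Lemma rankP (r : P -> nat) : is_rank_function r -> r =1 rank.
Proof.
case=> r0 rS x.
have rlt y z : y < z -> (r y < r z)%N.
  have [n] := ubnP (r z); elim: n z => // n IH z; rewrite ltnS => rzn yz.
  have [t yt tz] := ex_lower_cover yz.
  rewrite (rS _ _ tz) ltnS; move: yt; rewrite le_eqVlt => /orP[/eqP -> //|yt].
  by apply: ltnW; apply: IH => //; rewrite -(rS _ _ tz).
have rle y z : y <= z -> (r y <= r z)%N.
  by rewrite le_eqVlt => /orP[/eqP -> //|/rlt /ltnW].
apply/eqP; rewrite eqn_leq; apply/andP; split.
  have [C /andP[Cc Cx] Cr] : exists2 C : {set P},
      chain C && [forall y in C, y <= x] & #|C| = (r x).+1.
    have [n] := ubnP (r x); elim: n x => // n IH x; rewrite ltnS => rn.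
    case: (pickP (fun y => y < x)) => [y yx | xmin]; last first.
      exists [set x]; last by rewrite cards1 r0 // => y; rewrite xmin.
      apply/andP; split; last by apply/forall_inP => y /set1P ->.
      apply/forall_inP => y /set1P ->; apply/forall_inP => z /set1P ->.
      exact: comparablexx.
    have [z _ zx] := ex_lower_cover yx; have zltx : z < x by case/andP: zx.
    have [|C /andP[/forall_inP Cc /forall_inP Cz] Cr] := IH z.
      by rewrite (leq_trans _ rn) // (rS _ _ zx).
    have Cx t : t \in C -> t < x by move=> /Cz tz; apply: le_lt_trans zltx.
    exists (x |: C); last first.
      rewrite cardsU1 Cr (rS _ _ zx); case: (boolP (x \in C)) => // /Cx.
      by rewrite ltxx.
    apply/andP; split; last first.
      by apply/forall_inP => t /setU1P[-> //|/Cx /ltW].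
    apply/forall_inP => s /setU1P[->|sC]; apply/forall_inP => t /setU1P[->|tC].
    - exact: comparablexx.
    - by apply: ge_comparable; apply/ltW/Cx.
    - by apply: le_comparable; apply/ltW/Cx.
    - by have /forall_inP := Cc _ sC; apply.
  have -> : r x = #|C|.-1 by rewrite Cr.
  by rewrite /rank; apply: (leq_bigmax_cond (F := fun C : {set P} => #|C|.-1));
     rewrite Cc Cx.
apply/bigmax_leqP => C /andP[/forall_inP Cc /forall_inP Cx].
rewrite -subn1 leq_subLR add1n.
pose f (y : P) : 'I_(r x).+1 := inord (r y).
have fE y : y \in C -> f y = r y :> nat by move=> /Cx/rle ry; rewrite inordK.
rewrite -(card_ord (r x).+1) -(card_in_imset (f := f)) ?max_card //.
move=> y z yC zC /(congr1 (@nat_of_ord _)); rewrite !fE // => ryz.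
have /forall_inP /(_ _ zC) := Cc _ yC.
by case: comparableP => // /rlt; rewrite ryz ltnn.
Qed.

End FinPOrder.

Section CoreLabel.
Context (d : Order.disp_t) (L : finTBLatticeType d).
Implicit Types a b c : L.
Local Open Scope order_scope.

Definition label a b : L := [arg min_(c < b | a `|` c == b) c].

Definition Can a : {set L} := [set label b a | b : L & covers b a].

Definition nucleus a : L := a `&` \meet_(b : L | covers b a) b.

Definition Psi a : {set L} :=
  [set label p.1 p.2 | p : L * L &
     [&& nucleus a <= p.1, covers p.1 p.2 & p.2 <= a]].

Definition atoms : {set L} := [set a | covers \bot a].

Definition join_semidistributive : Prop :=
  forall a b c, a `|` b = a `|` c -> a `|` b = a `|` (b `&` c).

(* Under join-semidistributivity the minimum in [label] exists, so the default
   value [b] of [arg min] plays no role. *)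
Lemma labelP a b : join_semidistributive -> a <= b ->
  a `|` label a b = b /\ (forall c, a `|` c = b -> label a b <= c).
Proof.
move=> sd ab; pose m := \meet_(c : L | a `|` c == b) c.
have mb : a `|` m = b.
  have am : a `|` (b `&` m) = b.
    rewrite /m; elim/big_rec: _ => [|c x /eqP cb IH].
      by rewrite meetx1; apply/eqP; rewrite -leEjoin.
    by rewrite meetCA -sd // cb IH.
  apply/eqP; rewrite eq_le; apply/andP; split; last first.
    by rewrite -{1}am leUx leUl lexU2 // leIr orbT.
  rewrite leUx ab /=; apply: meets_inf; apply/eqP.
  by rewrite join_r.
have bP : a `|` b == b by rewrite join_r.
rewrite /label /Order.arg_min /extremum.
case: pickP => [c /andP[/eqP cb /forall_inP cmin] | /(_ m)] /=.
  by split=> // e /eqP /cmin.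
rewrite mb eqxx /= => /negP[]; apply/forall_inP => c cb.
exact: meets_inf.
Qed.

Lemma label_join a b : a <= b -> a `|` label a b = b.
Proof.
move=> ab; rewrite /label /Order.arg_min /extremum.
by case: pickP => [c /andP[/eqP]|_] //=; rewrite join_r.
Qed.

Lemma label_le a b : a <= b -> label a b <= b.
Proof. by move=> /label_join {2}<-; apply: leUr. Qed.

Lemma join_Psi a : \join_(c in Psi a) c = a.
Proof.
set j := LHS; have ja : j <= a.
  apply/joinsP => c /imsetP[[b b'] /=]; rewrite inE => /and3P[_ /andP[bb' _] b'a] ->.
  exact: le_trans (label_le (ltW bb')) b'a.
case: (eqVneq j a) => [//|jNa].
have [|b jb ba] := @ex_lower_cover _ L j a; first by rewrite lt_neqAle jNa.
have lPsi : label b a \in Psi a.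
  apply/imsetP; exists (b, a) => //; rewrite inE /= ba lexx andbT /nucleus.
  by rewrite leIx2 // meets_inf ?orbT.
have lj : label b a <= j by apply: (joins_min (j := label b a)).
have ltba : b < a by case/andP: ba.
have := label_join (ltW ltba); rewrite join_l ?(le_trans lj) // => ab.
by rewrite ab ltxx in ltba.
Qed.

Lemma Psi_inj : injective Psi.
Proof. by move=> a b ab; rewrite -[a]join_Psi ab join_Psi. Qed.

End CoreLabel.

(* An alias of the carrier, ordered by inclusion of core label sets. *)
Definition clo (d : Order.disp_t) (L : finTBLatticeType d) : Type := L.

HB.instance Definition _ (d : Order.disp_t) (L : finTBLatticeType d) :=
  Finite.copy (clo L) L.

Fact clo_display : Order.disp_t. Proof. exact: Order.Disp tt tt. Qed.

Section CloOrder.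
Context (d : Order.disp_t) (L : finTBLatticeType d).

Definition clo_le : rel (clo L) := fun a b => Psi (a : L) \subset Psi (b : L).

Fact clo_le_refl : reflexive clo_le.
Proof. by move=> a; apply: subxx. Qed.

Fact clo_le_anti : antisymmetric clo_le.
Proof. by move=> a b ab; apply: (@Psi_inj _ L); apply/eqP; rewrite eqEsubset. Qed.

Fact clo_le_trans : transitive clo_le.
Proof. by move=> b a c; apply: subset_trans. Qed.

HB.instance Definition _ :=
  Order.Le_isPOrder.Build clo_display (clo L)
    clo_le_refl clo_le_anti clo_le_trans.

End CloOrder.

(* Positions are numbered from 0. *)
Definition is_triword (n : nat) (u : {ffun 'I_n -> 'I_3}) : bool :=
  [forall i : 'I_n, (i == 0 :> nat) ==> (u i != 2 :> nat)] &&
  [forall i : 'I_n, forall j : 'I_n,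
     (i < j) && (u i == 0 :> nat) ==> (u j != 1 :> nat)].

Record triword (n : nat) := Triword {
  tri_fun :> {ffun 'I_n -> 'I_3};
  _ : is_triword tri_fun
}.

HB.instance Definition _ (n : nat) := [isSub for @tri_fun n].
HB.instance Definition _ (n : nat) := [Finite of triword n by <:].

Fact hoch_display : Order.disp_t. Proof. exact: Order.Disp tt tt. Qed.

Section Hochschild.
Context (n : nat).
Implicit Types u v w : triword n.

Lemma triwordP (f : {ffun 'I_n -> 'I_3}) :
  reflect ((forall i : 'I_n, i = 0 :> nat -> f i <> 2 :> nat) /\
           (forall i j : 'I_n, i < j -> f i = 0 :> nat -> f j <> 1 :> nat))
          (is_triword f).
Proof.
apply: (iffP andP) => [[/forallP t2 /forallP t3]|[t2 t3]]; split.
- by move=> i /eqP i0; apply/eqP; have /implyP := t2 i; apply.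
- move=> i j ij /eqP fi; apply/eqP.
  by have /forallP /(_ j) /implyP := t3 i; apply; rewrite ij.
- by apply/forallP => i; apply/implyP => /eqP /t2 /eqP.
- apply/forallP => i; apply/forallP => j; apply/implyP => /andP[ij /eqP fi].
  by apply/eqP; apply: t3 ij fi.
Qed.

Definition hoch_le : rel (triword n) := fun u v => [forall i, u i <= v i].

Fact hoch_le_refl : reflexive hoch_le.
Proof. by move=> u; apply/forallP. Qed.

Fact hoch_le_anti : antisymmetric hoch_le.
Proof.
move=> u v /andP[/forallP uv /forallP vu]; apply: val_inj; apply/ffunP => i.
by apply: val_inj; apply/eqP; rewrite eqn_leq uv vu.
Qed.

Fact hoch_le_trans : transitive hoch_le.
Proof.
move=> v u w /forallP uv /forallP vw; apply/forallP => i.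
exact: leq_trans (uv i) (vw i).
Qed.

HB.instance Definition _ :=
  Order.Le_isPOrder.Build hoch_display (triword n)
    hoch_le_refl hoch_le_anti hoch_le_trans.

Definition min_fun u v : {ffun 'I_n -> 'I_3} :=
  [ffun i => Order.min (u i) (v i)].

Definition join_fun u v : {ffun 'I_n -> 'I_3} :=
  [ffun i => Order.max (u i) (v i)].

Definition meet_fun u v : {ffun 'I_n -> 'I_3} :=
  [ffun i =>
     if (min_fun u v i == 1 :> nat) &&
        [exists j : 'I_n, (j < i) && (min_fun u v j == 0 :> nat)]
     then ord0 else min_fun u v i].

Lemma min_funE u v i : min_fun u v i = minn (u i) (v i) :> nat.
Proof. by rewrite ffunE /Order.min ltEord /minn; case: ifP. Qed.

Lemma join_funE u v i : join_fun u v i = maxn (u i) (v i) :> nat.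
Proof. by rewrite ffunE /Order.max ltEord /maxn; case: ifP. Qed.

Lemma triS u : is_triword u. Proof. by case: u. Qed.

Fact join_subproof u v : is_triword (join_fun u v).
Proof.
have [u2 u3] := triwordP _ (triS u); have [v2 v3] := triwordP _ (triS v).
apply/triwordP; split=> [i i0 | i j ij]; rewrite !join_funE.
  by rewrite /maxn; case: ifP => _; [apply: v2|apply: u2].
move/eqP; rewrite -leqn0 geq_max !leqn0 => /andP[/eqP ui /eqP vi].
by rewrite /maxn; case: ifP => _; [apply: v3 vi|apply: u3 ui].
Qed.

Fact meet_subproof u v : is_triword (meet_fun u v).
Proof.
have [u2 u3] := triwordP _ (triS u); have [v2 v3] := triwordP _ (triS v).
apply/triwordP; split=> [i i0 | i j ij].
  rewrite ffunE; case: ifP => // _; rewrite min_funE /minn.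
  by case: ifP => _; [apply: u2|apply: v2].
rewrite ![meet_fun _ _ _]ffunE => mi; case: ifP => // /negP jN /eqP mj.
apply: jN; rewrite mj /=; apply/existsP.
move: mi; case: ifP => [/andP[_ /existsP[k /andP[ki mk]]] _ | _ /eqP mi].
  by exists k; rewrite mk (ltn_trans ki ij).
by exists i; rewrite ij mi.
Qed.

Definition hoch_join u v : triword n := Triword (join_subproof u v).
Definition hoch_meet u v : triword n := Triword (meet_subproof u v).

Fact hoch_joinP u v w : (hoch_join u v <= w)%O = (u <= w)%O && (v <= w)%O.
Proof.
apply/forallP/andP => [h | [/forallP uw /forallP vw] i]; last first.
  by rewrite join_funE geq_max uw vw.
by split; apply/forallP => i; have := h i; rewrite join_funE geq_max => /andP[].
Qed.

Fact hoch_meetP u v w : (u <= hoch_meet v w)%O = (u <= v)%O && (u <= w)%O.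
Proof.
apply/forallP/andP => [h | [/forallP uv /forallP uw] i].
  have h' i : u i <= min_fun v w i.
    by apply: (leq_trans (h i)); rewrite ffunE; case: ifP.
  by split; apply/forallP => i; have := h' i; rewrite min_funE leq_min => /andP[].
have um j : u j <= min_fun v w j by rewrite min_funE leq_min uv uw.
rewrite ffunE; case: ifP => // /andP[/eqP mi /existsP[j /andP[ji /eqP mj]]].
have := um i; rewrite mi; have := um j; rewrite mj leqn0 => /eqP uj ui.
have [_ /(_ j i ji uj)] := triwordP _ (triS u).
by case: (nat_of_ord (u i)) ui => [|[]].
Qed.

HB.instance Definition _ :=
  Order.POrder_MeetJoin_isLattice.Build hoch_display (triword n)
    hoch_meetP hoch_joinP.

Fact bot_subproof : is_triword [ffun _ : 'I_n => ord0 : 'I_3].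
Proof. by apply/triwordP; split=> [i|i j]; rewrite !ffunE. Qed.

Fact top_subproof :
  is_triword [ffun i : 'I_n => (if i == 0 :> nat then inord 1 else ord_max) : 'I_3].
Proof.
apply/triwordP; split=> [i|i j ij]; rewrite !ffunE; first by move=> ->; rewrite inordK.
by case: ifP => // _; rewrite inordK.
Qed.

Fact hoch_le0 u : (Triword bot_subproof <= u)%O.
Proof. by apply/forallP => i; rewrite ffunE. Qed.

Fact hoch_le1 u : (u <= Triword top_subproof)%O.
Proof.
apply/forallP => i; rewrite ffunE; case: ifP => [/eqP i0|_]; last exact: leq_ord.
have [/(_ i i0) + _] := triwordP _ (triS u); rewrite inordK //.
by case: (u i) => [[|[|[|]]]].
Qed.

HB.instance Definition _ :=
  Order.hasBottom.Build hoch_display (triword n) hoch_le0.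
HB.instance Definition _ :=
  Order.hasTop.Build hoch_display (triword n) hoch_le1.

Lemma hoch_join_semidistributive : @join_semidistributive _ (triword n).
Proof.
move=> a b c abc; apply: val_inj; apply/ffunP => i; apply: val_inj.
have E w j : (a `|` w)%O j = maxn (a j) (w j) :> nat by exact: join_funE.
have abcj j : maxn (a j) (b j) = maxn (a j) (c j) by rewrite -!E abc.
change ((a `|` b)%O i = (a `|` (b `&` c))%O i :> nat); rewrite !E.
have -> : (b `&` c)%O i = meet_fun b c i by [].
rewrite ffunE; case: ifP => [/andP[/eqP mi /existsP[j /andP[ji /eqP mj]]]|_].
  have [_ b3] := triwordP _ (triS b); have [_ c3] := triwordP _ (triS c).
  rewrite maxn0; apply/maxn_idPl; rewrite leqNgt; apply/negP => ab.
  have bc : c i = b i :> nat.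
    have := abcj i; rewrite (maxn_idPr (ltnW ab)) /maxn.
    by case: ifP => // _ ba; rewrite ba ltnn in ab.
  move: mi mj; rewrite !min_funE bc minnn /minn => b1.
  by case: ifP => _ j0; [case: (b3 j i ji j0)|case: (c3 j i ji j0); rewrite bc].
by rewrite min_funE maxn_minr -abcj minnn.
Qed.

Definition neg u : nat := #|Can u :&: atoms (triword n)|.

End Hochschild.

Local Open Scope ring_scope.

Definition M_triangle (K : comPzRingType) (n : nat) (x y : K) : K :=
  \sum_(u : clo (triword n)) \sum_(v : clo (triword n))
    (mobius u v)%:~R * x ^+ rank u * y ^+ rank v.

(* Used at the two indeterminates of a rational function field, where the
   denominators [y - x] and [y] do not vanish. *)
Definition F_triangle (K : fieldType) (n : nat) (x y : K) : K :=
  y ^+ n * M_triangle n ((y + 1) / (y - x)) ((y - x) / y).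

(* Q(x, y) and its two indeterminates. *)
Definition ratfun2 : fieldType := {fraction {mpoly rat[2]}}.
Definition varx : ratfun2 := tofrac ('X_ord0 : {mpoly rat[2]}).
Definition vary : ratfun2 := tofrac ('X_ord_max : {mpoly rat[2]}).

(* Main.v *)
(* A triword u is encoded by the pair (S, f), where S is the set of positions of
   its 2s and f is the position of its first 0 (f = n if there is none).  Writing
   a_i for the atom with a 2 in position i and b_p for the element with 1s
   exactly in positions 0..p, the core label set is
     Psi(u) = {a_i : i in S} + {b_p : p < f, and p+1, ..., f-1 all lie in S},
   so (S, f) lies below (S', f') in the core label order iff S is a subset of S'
   and either f = 0, or f <= f' and f, ..., f'-1 all lie in S'.  The rank is
   |Can(u)| = |S| + [f > 0].  Let m(S, f) be the length of the run of S that ends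
   just before f.  With T = X - 1, the function G(S, 0) = T^|S| and
   G(S, f) = T^|S| (T - m(S, f)) for f > 0 sums to X^rk(v) over the elements
   below v, so G(v) = \sum_u mu(u, v) X^rk(u) by Möbius inversion.  Since the runs
   of S partition S, both sides of the theorem become sums over subsets S of
   {1, ..., n-1}, and both equal
     (x + y + 1)^n + (n - 1) x (x + 1) (x + y + 1)^(n - 2). *)
Require Import Defs.
From mathcomp Require Import all_boot all_order all_algebra.
From mathcomp Require Import mpoly zify ring.
Import Order.TTheory GRing.Theory.
Set Implicit Arguments.
Unset Strict Implicit.
Unset Printing Implicit Defensive.

(** * Möbius inversion in a finite poset *)

Section MobiusInversion.
Local Open Scope ring_scope.
Context (d : Order.disp_t) (P : finPOrderType d).

Lemma mobius_eq0 (x y : P) : ~~ (x <= y)%O -> mobius x y = 0.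
Proof.
move=> xy; rewrite mobiusE; case: eqP => [xy'|_]; first by rewrite xy' lexx in xy.
rewrite big_pred0 ?oppr0 // => z; apply/negbTE/negP => /andP[xz zy].
by move/negP: xy; apply; apply: le_trans xz (ltW zy).
Qed.

(** Terms outside the interval from [x] to [y] vanish, and inside it the recursion [mobiusE] makes
    the term at [y] cancel all others unless [x = y]. *)
Lemma sum_mobius_r (x y : P) :
  \sum_(z : P | (z <= y)%O) mobius x z = (x == y)%:R.
Proof.
have -> : \sum_(z : P | (z <= y)%O) mobius x z
        = \sum_(z : P | (x <= z <= y)%O) mobius x z.
  rewrite [LHS](bigID (fun z => (x <= z)%O)) /= [X in _ + X]big1 ?addr0.
    by apply: eq_bigl => z; rewrite andbC.
  by move=> z /andP[_ /mobius_eq0].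
have [->|xy] := eqVneq x y.
  rewrite (bigD1 y) ?lexx //= big1 ?addr0 ?mobiusE ?eqxx //.
  by move=> z /andP[/le_anti -> ]; rewrite eqxx.
have [lexy|nxy] := boolP (x <= y)%O; last first.
  rewrite big_pred0 // => z; apply/negbTE/negP => /andP[xz zy].
  by move/negP: nxy; apply; apply: le_trans xz zy.
rewrite (bigD1 y) ?lexy ?lexx //= mobiusE (negbTE xy).
apply/eqP; rewrite addrC subr_eq0; apply/eqP/eq_bigl => z.
by rewrite lt_neqAle -andbA [(z <= y)%O && _]andbC.
Qed.

(* A left inverse of the zeta matrix is also a right inverse. *)
Lemma sum_mobius_l (x y : P) :
  \sum_(z : P | (x <= z)%O) mobius z y = (x == y)%:R.
Proof.
pose M := \matrix_(i < #|P|, j < #|P|) mobius (enum_val i) (enum_val j).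
pose Z := \matrix_(i < #|P|, j < #|P|)
  ((enum_val i <= enum_val j)%O%:R : int).
have MZ : M *m Z = 1%:M.
  apply/matrixP => i j; rewrite !mxE -(inj_eq enum_val_inj) -sum_mobius_r.
  rewrite [RHS]big_mkcond [RHS](reindex _ (onW_bij _ (@enum_val_bij P))) /=.
    by apply: eq_bigr => k _; rewrite !mxE mulr_natr mulrb.
have /matrixP/(_ (enum_rank x) (enum_rank y)) := mulmx1C MZ.
rewrite !mxE (inj_eq enum_rank_inj) => <-.
rewrite [LHS]big_mkcond [LHS](reindex _ (onW_bij _ (@enum_val_bij P))) /=.
by apply: eq_bigr => k _; rewrite !mxE !enum_rankK mulr_natl mulrb.
Qed.

(** After exchanging the sums, [g w] is multiplied by the sum of [mobius u v] over [u] above [w],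
    which [sum_mobius_l] reduces to a Kronecker delta. *)
Lemma mobius_inversion (K : pzRingType) (f g : P -> K) :
  (forall v, f v = \sum_(u : P | (u <= v)%O) g u) ->
  forall v, \sum_(u : P) (mobius u v)%:~R * f u = g v.
Proof.
move=> fE v.
under eq_bigr => u _ do rewrite fE big_mkcond mulr_sumr.
rewrite exchange_big /=.
have E w : \sum_u (mobius u v)%:~R * (if (w <= u)%O then g w else 0)
    = (w == v)%:R * g w.
  rewrite -[(w == v)%:R](rmorph_nat (intmul 1)) -sum_mobius_l rmorph_sum mulr_suml.
  rewrite [RHS]big_mkcond.
  by apply: eq_bigr => u _; case: ifP; rewrite ?mulr0.
under eq_bigr => w _ do rewrite E.
rewrite (bigD1 v) //= eqxx mul1r big1 ?addr0 // => w /negbTE ->.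
by rewrite mul0r.
Qed.

End MobiusInversion.

(** * Weighted sums over the subsets of a finite set *)

Section SubsetSums.
Local Open Scope ring_scope.
Context (R : comPzRingType) (I : finType) (D : {set I}) (a b : R).

(** The padding prepares for [bigA_distr], which expands a product over the whole type into a sum
    over all subsets: the factor 0 discards sets not contained in [D], the factor 1 neutralises
    positions outside [D]. *)
Lemma prod_over_subset (S : {set I}) (F G : I -> R) : 
  \prod_(i : I) (if i \in S then if i \in D then F i else 0
                 else if i \in D then G i else 1)
  = if S \subset D then \prod_(i in S) F i * \prod_(i in D :\: S) G i else 0.
Proof.
case: ifP => [SD|/negbT/subsetPn[i iS iD]]; last first.
  by rewrite (bigD1 i) //= iS (negbTE iD) mul0r.
rewrite (bigID (mem S)) /=; congr (_ * _).
  by apply: eq_bigr => i iS; rewrite iS (subsetP SD).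
rewrite [RHS]big_mkcond [LHS]big_mkcond; apply: eq_bigr => i _.
by rewrite inE; case: (i \in S); case: (i \in D).
Qed.

Lemma sum_subset_prod (F G : I -> R) :
  \sum_(S : {set I} | S \subset D) \prod_(i in S) F i * \prod_(i in D :\: S) G i
  = \prod_(i in D) (F i + G i).
Proof.
rewrite big_mkcond; under eq_bigr => S _ do rewrite -prod_over_subset.
rewrite -(bigA_distr _ _ (fun i => if i \in D then F i else 0)
  (fun i => if i \in D then G i else 1)) [RHS]big_mkcond.
by apply: eq_bigr => i _ /=; case: (i \in D); rewrite ?add0r.
Qed.

(** Both sides of the theorem become sums of this weight over the subsets of [inner n], with
    [(a, b)] equal to [(x + 1, y)] for the F-triangle and to [(y + 1, x)] for the other side. *)
Definition wt (S : {set I}) : R := a ^+ #|S| * b ^+ #|D :\: S|.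

Lemma sum_wt : \sum_(S : {set I} | S \subset D) wt S = (a + b) ^+ #|D|.
Proof.
rewrite -prodr_const -sum_subset_prod.
by apply: eq_bigr => S _; rewrite !prodr_const.
Qed.

(** A factor that depends only on whether [q] lies in [S] turns the weights at [q] into [a * c] and
    [b * e], so just one factor of the product formula changes. *)
Lemma sum_wt_mem (q : I) (c e : R) : q \in D ->
  \sum_(S : {set I} | S \subset D) wt S * (if q \in S then c else e)
  = (a * c + b * e) * (a + b) ^+ #|D|.-1.
Proof.
move=> qD; pose F i := if i == q then a * c else a.
pose G i := if i == q then b * e else b.
transitivity (\prod_(i in D) (F i + G i)).
  rewrite -sum_subset_prod; apply: eq_bigr => S SD.
  have E (T : {set I}) (h : I -> R) x y :
     (forall i, h i = if i == q then x * y else x) ->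
     \prod_(i in T) h i = x ^+ #|T| * (if q \in T then y else 1).
    move=> hE; case: ifP => qT; last first.
      rewrite mulr1 -prodr_const; apply: eq_bigr => i iT; rewrite hE.
      by case: eqP => // iq; rewrite -iq iT in qT.
    rewrite (bigD1 q) //= hE eqxx (cardD1 q) qT exprS -!mulrA; congr (_ * _).
    rewrite mulrC; congr (_ * _); rewrite -prodr_const; apply: eq_big => i.
      by rewrite !inE andbC.
    by case/andP => _ iq; rewrite hE (negbTE iq).
  rewrite (E _ F a c) // (E _ G b e) // inE qD andbT /wt.
  by case: (q \in S); rewrite /= !mulr1 -?mulrA //; congr (_ * _); rewrite mulrC.
rewrite (bigD1 q) //= /F /G eqxx; congr (_ * _).
rewrite (cardD1 q) qD /= -prodr_const; apply: eq_big => i; first by rewrite !inE andbC.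
by case/andP=> _ /negbTE ->.
Qed.

(** Both cardinalities are sums of indicators over [q] in [Q], and by [sum_wt_mem] every [q]
    contributes the same amount. *)
Lemma sum_wt_card (Q : {set I}) (c e : R) : Q \subset D ->
  \sum_(S : {set I} | S \subset D)
     wt S * (c * #|Q :&: S|%:R + e * #|Q :\: S|%:R)
  = #|Q|%:R * ((a * c + b * e) * (a + b) ^+ #|D|.-1).
Proof.
move=> /subsetP QD; rewrite mulr_natl -sumr_const.
under [RHS]eq_bigr => q /QD qD do rewrite -(sum_wt_mem c e qD).
rewrite exchange_big /=; apply: eq_bigr => S _; rewrite -mulr_sumr; congr (_ * _).
rewrite !mulr_natr -!sumr_const [RHS](bigID (mem S)) /=.
congr (_ + _); apply: eq_big => q; rewrite ?inE //.
- by move/andP=> [_ ->].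
- by rewrite andbC.
- by move/andP=> [/negbTE ->].
Qed.

End SubsetSums.

(** * Runs and gaps in a set of positions *)

Section Runs.
Context (n : nat).
Implicit Types (S D : {set 'I_n.+1}) (e f g i j : 'I_n.+1).

Definition filled S (a b : nat) : bool :=
  [forall j : 'I_n.+1, (a <= j < b) ==> (j \in S)].

Lemma filledP S (a b : nat) :
  reflect (forall j : 'I_n.+1, (a <= j) -> (j < b) -> j \in S) (filled S a b).
Proof.
apply: (iffP forallP) => h j; first by move=> aj jb; have := h j; rewrite aj jb.
by apply/implyP => /andP[]; apply: h.
Qed.

(** The block of consecutive elements of [S] that ends just before [e]; its size is the m(S, e) of
    the overview. *)
Definition run S e : {set 'I_n.+1} := [set i : 'I_n.+1 | (i < e) && filled S i e].

Lemma in_run S e i : (i \in run S e) = (i < e) && filled S i e.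
Proof. by rewrite inE. Qed.

Lemma run_sub S e : run S e \subset S.
Proof. by apply/subsetP => i; rewrite in_run => /andP[ie /filledP]; apply. Qed.

(** At [f = e] the interval is empty, so adding [e] to its run only relaxes the strict bound. For a
    triword with set of 2s [S] and first zero [e], this set holds the candidates for nonzero first
    zeros below it in the core label order. *)
Lemma in_cap S e f : (f \in e |: run S e) = (f <= e) && filled S f e.
Proof.
rewrite !inE [(f <= e)]leq_eqVlt (inj_eq val_inj).
case: eqP => //= ->; apply/esym/filledP => j ej je.
by have := leq_ltn_trans ej je; rewrite ltnn.
Qed.

Lemma first_gap S i e : (i <= e) -> e \notin S ->
  exists2 f : 'I_n.+1, [/\ i <= f, f <= e & f \notin S] & filled S i f.
Proof.
move=> ie eS.
have P0 : [pred f : 'I_n.+1 | (i <= f) && (f \notin S)] e by rewrite /= ie.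
case: (arg_minnP (fun f : 'I_n.+1 => f : nat) P0) => f /andP[lif fS] fmin.
exists f; first by split=> //; apply: fmin; rewrite /= ie.
apply/filledP => j ij jf; apply/negPn/negP => jS.
by have := fmin j; rewrite /= ij jS leqNgt jf => /(_ isT).
Qed.

Lemma gap_unique S i f g : (i <= f) -> (i <= g) -> f \notin S -> g \notin S ->
  filled S i f -> filled S i g -> f = g.
Proof.
move=> lif lig fS gS /filledP Ff /filledP Fg; apply: val_inj => /=.
case: (ltngtP f g) => // h.
  by have := Fg f lif h; rewrite (negbTE fS).
by have := Ff g lig h; rewrite (negbTE gS).
Qed.

(* Every element of [run D e :&: S] lies in the run of exactly one gap of [S],
   the first one to its right. *)
Lemma sum_run S D e : S \subset D -> e \notin S ->
  (\sum_(f in (e |: run D e) :\: S) #|run S f| = #|run D e :&: S|).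
Proof.
move=> /subsetP SD eS.
under eq_bigr => f _ do rewrite -sum1_card big_mkcond.
rewrite exchange_big /= -sum1_card [RHS]big_mkcond; apply: eq_bigr => i _.
rewrite -big_mkcondr /= sum1dep_card.
case: (boolP (i \in run D e :&: S)) => [|iN].
  rewrite inE in_run => /andP[/andP[ie /filledP iF] iS].
  have [f [lif fe fS] fF] := first_gap (ltnW ie) eS.
  have lt_if : (i < f).
    by rewrite ltn_neqAle lif andbT; apply/eqP => /val_inj E; rewrite -E iS in fS.
  apply/eqP/cards1P; exists f; apply/setP => g; rewrite inE [in RHS]inE.
  apply/andP/eqP => [[/setDP[_ gS]]|->].
    rewrite in_run => /andP[/ltnW ig gF].
    exact: gap_unique gF fF.
  have : f \in e |: run D e.
    rewrite in_cap fe; apply/filledP => j fj je.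
    by apply: iF je; apply: leq_trans fj.
  by rewrite in_run in_setD fS lt_if fF => ->.
(* If [i] lies in the run of a gap [g], the positions from [i] to [g] are in [S], hence in [D], and
   those from [g] to [e] are in [D]; so [i] lies in [run D e :&: S] after all. *)
apply/eqP; rewrite cards_eq0; apply/eqP/setP => g; rewrite [RHS]inE.
rewrite inE; apply/negbTE; apply: contra iN => /andP[/setDP[gR gS] ig].
rewrite inE (subsetP (run_sub _ _) _ ig) andbT.
move: gR ig; rewrite in_cap !in_run => /andP[ge /filledP gF] /andP[ig /filledP iF].
rewrite (leq_trans ig ge); apply/filledP => j ij je.
by case: (leqP g j) => [gj|jg]; [apply: gF|apply/SD/iF].
Qed.

Lemma card_cap_diff S D e : e \notin S ->
  #|(e |: run D e) :\: S| = #|run D e :\: S|.+1.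
Proof.
move=> eS; have -> : (e |: run D e) :\: S = e |: (run D e :\: S).
  by apply/setP => i; rewrite !inE; case: eqP => // ->; rewrite eS.
by rewrite cardsU1 !inE ltnn andbF.
Qed.

End Runs.

(** * Encoding triwords by the set of 2s and the first zero *)

Section Triwords.
Context (n : nat).
Implicit Types (u v w : triword n) (S : {set 'I_n.+1}) (f : 'I_n.+1).

(* Extending triwords by 0 beyond position [n] gives every triword a first zero. *)
Definition entry u (i : nat) : nat := if insub i is Some k then u k else 0.

Definition wf_entries (g : nat -> nat) : Prop :=
  [/\ forall i, (g i <= 2), g 0 <> 2,
      forall i j, (i < j) -> g i = 0 -> g j <> 1
    & forall i, (n <= i) -> g i = 0].

Lemma entry_ord u (k : 'I_n) : entry u k = u k.
Proof. by rewrite /entry valK. Qed.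

Lemma entry_wf u : wf_entries (entry u).
Proof.
have out i : (n <= i) -> entry u i = 0.
  by move=> ni; rewrite /entry; case: insubP => // k; rewrite ltnNge ni.
have [u2 u3] := triwordP _ (triS u); split=> //.
- by move=> i; rewrite /entry; case: insubP => // k _ _; rewrite -ltnS.
- by rewrite /entry; case: insubP => // k _ k0; apply: u2.
- move=> i j ij; case: (ltnP j n) => [jn|/out -> //].
  have lin := ltn_trans ij jn.
  have := u3 (Ordinal lin) (Ordinal jn) ij.
  by rewrite -!entry_ord.
Qed.

Lemma entry_eq i u v : u = v -> entry u i = entry v i.
Proof. by move->. Qed.

Lemma entry_inj u v : entry u =1 entry v -> u = v.
Proof.
move=> uv; apply: val_inj; apply/ffunP => k; apply: val_inj.
by rewrite /= -!entry_ord uv.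
Qed.

Lemma entry_le u v : reflect (forall i, (entry u i <= entry v i)) (u <= v)%O.
Proof.
apply: (iffP forallP) => h i; last by rewrite -!entry_ord.
by rewrite /entry; case: insubP.
Qed.

Lemma entry_join u v i : entry (u `|` v)%O i = maxn (entry u i) (entry v i).
Proof. by rewrite /entry; case: insubP => // k _ _; exact: join_funE. Qed.

Lemma entry_bot i : entry \bot%O i = 0.
Proof.
rewrite /entry; case: insubP => // k _ _.
by rewrite (_ : \bot%O = Triword (bot_subproof n)) //= ffunE.
Qed.

(** The default value of [insubd] avoids carrying a proof of well-formedness; [mktriE] recovers the
    entries whenever [wf_entries] holds. *)
Definition mktri (g : nat -> nat) : triword n :=
  insubd (\bot%O : triword n) [ffun k : 'I_n => inord (g k) : 'I_3].

Lemma mktriE g : wf_entries g -> entry (mktri g) =1 g.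
Proof.
move=> [g2 g0 g3 gn] i; rewrite /entry; case: insubP => [k _ <-|]; last first.
  by rewrite -leqNgt => /gn ->.
have E (l : 'I_n) : [ffun k : 'I_n => inord (g k) : 'I_3] l = g l :> nat.
  by rewrite ffunE inordK // ltnS.
have wf : is_triword [ffun k : 'I_n => inord (g k) : 'I_3].
  by apply/triwordP; split=> [j j0|j l]; rewrite !E; [rewrite j0|apply: g3].
by rewrite /mktri /insubd insubT /= E.
Qed.

(** The positions that may carry a 2: (T2) excludes position 0, and [n] lies beyond the word. *)
Definition inner : {set 'I_n.+1} := [set i : 'I_n.+1 | (0 < i < n)].
Definition twos u : {set 'I_n.+1} := [set i : 'I_n.+1 | entry u i == 2].
(** [find] returns [n] when there is no zero, hence the type ['I_n.+1]. *)
Definition fz u : 'I_n.+1 := inord (find (fun i => entry u i == 0) (iota 0 n)).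
(** Inverse of the encoding [u |-> (twos u, fz u)] on the pairs with [S] inside [inner] and [f]
    outside [S]. *)
Definition tri S f : triword n :=
  mktri (fun i => if i \in [seq val k | k in S] then 2 else (i < f)).

Lemma fz_zero u : entry u (fz u) = 0.
Proof.
have le_n : (find (fun i => entry u i == 0) (iota 0 n) <= n).
  by rewrite -[X in (_ <= X)](size_iota 0) find_size.
rewrite /fz inordK ?ltnS //.
have [h|h] := boolP (has (fun i => entry u i == 0) (iota 0 n)).
  have /eqP := nth_find 0 h; rewrite nth_iota //.
  by move: h; rewrite has_find size_iota.
rewrite hasNfind // size_iota.
by have [_ _ _ ->] := entry_wf u.
Qed.

Lemma lt_fz u (i : nat) : (i < fz u) -> entry u i != 0.
Proof.
have le_n : (find (fun i => entry u i == 0) (iota 0 n) <= n).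
  by rewrite -[X in (_ <= X)](size_iota 0) find_size.
rewrite /fz inordK ?ltnS // => h.
by have := before_find 0 h; rewrite nth_iota ?(leq_trans h) //= => /negbT.
Qed.

Lemma ge_fz u (i : nat) : (fz u <= i) -> entry u i <> 1.
Proof.
have [_ _ u3 _] := entry_wf u.
rewrite leq_eqVlt => /orP[/eqP <-|/u3]; first by rewrite fz_zero.
by apply; apply: fz_zero.
Qed.

(** By (T3) no 1 occurs after the first zero, so away from the 2s the entries are 1 before [fz u]
    and 0 from there on. *)
Lemma entryE u f : entry u f = if f \in twos u then 2 else (f < fz u).
Proof.
rewrite inE; case: eqP => [//|f2]; have [u2 _ _ _] := entry_wf u.
have := u2 f; case: (ltnP f (fz u)) => [/lt_fz|/ge_fz] /=; lia.
Qed.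

Lemma twos_inner u : twos u \subset inner.
Proof.
apply/subsetP => i; rewrite !inE => /eqP i2; have [_ u0 _ un] := entry_wf u.
rewrite lt0n ltnNge; apply/andP; split; first by apply/eqP => i0; move: i2; rewrite i0.
by apply/negP => /un; rewrite i2.
Qed.

Lemma fz_twos u : fz u \notin twos u.
Proof. by rewrite inE fz_zero. Qed.

Lemma tri_val S f : S \subset inner -> f \notin S ->
  entry (tri S f) =1 fun i => if i \in [seq val k | k in S] then 2 else (i < f).
Proof.
move=> /subsetP SD fS; apply: mktriE.
have mS i : i \in [seq val k | k in S] -> (0 < i < n).
  by case/mapP => k; rewrite mem_enum => /SD; rewrite inE => kD ->.
have mf : (f : nat) \notin [seq val k | k in S].
  by rewrite (mem_map val_inj) mem_enum.
split.
- by move=> i; case: ifP => //; case: (i < f).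
- by case: ifP => [/mS //|_]; case: (0 < f).
- move=> i j ij; case: ifP => // _; case: ifP => // _; lia.
- move=> i ni; case: ifP => [/mS|_]; first lia.
  by have := ltn_ord f; lia.
Qed.

Lemma tri_val_ord S f (i : 'I_n.+1) : S \subset inner -> f \notin S ->
  entry (tri S f) i = if i \in S then 2 else (i < f).
Proof. by move=> SD fS; rewrite tri_val // (mem_map val_inj) mem_enum. Qed.

Lemma twos_tri S f : S \subset inner -> f \notin S -> twos (tri S f) = S.
Proof.
move=> SD fS; apply/setP => i; rewrite inE tri_val_ord //.
by case: (i \in S) => //; case: (i < f).
Qed.

Lemma fz_tri S f : S \subset inner -> f \notin S -> fz (tri S f) = f.
Proof.
move=> SD fS; apply: val_inj => /=.
have := fz_zero (tri S f); rewrite tri_val_ord //; case: ifP => // _ h.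
case: (ltngtP f (fz (tri S f))) => // [/lt_fz|]; last by lia.
by rewrite tri_val_ord // (negbTE fS) ltnn.
Qed.

Lemma triword_eq u v : twos u = twos v -> fz u = fz v -> u = v.
Proof.
move=> ST fE; apply: entry_inj => i; have [_ _ _ un] := entry_wf u.
have [_ _ _ vn] := entry_wf v; case: (ltnP i n.+1) => [lin|/ltnW nli].
  by rewrite -[i]/(val (Ordinal lin)) !entryE ST fE.
by rewrite un ?vn.
Qed.

Lemma triK u : tri (twos u) (fz u) = u.
Proof.
by apply: triword_eq; rewrite ?twos_tri ?fz_tri ?twos_inner ?fz_twos.
Qed.

Lemma sum_triword (V : nmodType) (P : pred (triword n)) (F : triword n -> V) :
  (\sum_(u | P u) F u =
  \sum_(S : {set 'I_n.+1} | S \subset inner)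
     \sum_(f | (f \notin S) && P (tri S f)) F (tri S f))%R.
Proof.
rewrite pair_big_dep /=.
rewrite (reindex_onto (fun p => tri p.1 p.2) (fun u => (twos u, fz u))) /=.
  apply: eq_bigl => -[S f] /=; rewrite xpair_eqE.
  apply/and3P/and3P => [[PS /eqP ST /eqP fE]|[SD fS PS]].
    by rewrite PS; have := fz_twos (tri S f); have := twos_inner (tri S f); rewrite ST fE.
  by rewrite PS twos_tri ?fz_tri.
by move=> u _; apply: triK.
Qed.

End Triwords.

(** * Lower covers, their labels and the core label sets *)

Section CoreLabels.
Context (n : nat).
Implicit Types (u v w z : triword n) (i p : nat).

(* Only meaningful for [0 < i < n] and [p < n]: for values that do not form a
   triword, [mktri] returns [\bot]. *)
Definition two_at i : triword n := mktri n (fun j => if j == i then 2 else 0).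
Definition ones_to p : triword n := mktri n (fun j => (j <= p) : nat).

Lemma two_atE i j : (0 < i < n) -> entry (two_at i) j = if j == i then 2 else 0.
Proof.
move=> /andP[i0 lin]; apply: mktriE; split.
- by move=> k; case: ifP.
- by case: eqP => // E; rewrite -E in i0.
- by move=> k l; case: eqP; case: eqP.
- by move=> k nk; case: eqP => // E; move: nk; rewrite E leqNgt lin.
Qed.

Lemma ones_toE p j : (p < n) -> entry (ones_to p) j = (j <= p).
Proof.
move=> pn; apply: mktriE; split.
- by move=> k; case: (k <= p).
- by case: (0 <= p).
- by move=> k l; lia.
- by move=> k; lia.
Qed.

Lemma two_at_le i u : (0 < i < n) -> (two_at i <= u)%O = (entry u i == 2).
Proof.
move=> iD; have [u2 _ _ _] := entry_wf u; apply/entry_le/eqP => [/(_ i)|ui j].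
  by rewrite two_atE // eqxx; have := u2 i; lia.
by rewrite two_atE //; case: eqP => // ->; rewrite ui.
Qed.

Lemma ones_to_le p u : (p < n) -> (ones_to p <= u)%O = (p < fz u).
Proof.
move=> pn; apply/entry_le/idP => [h|pf j]; last first.
  rewrite ones_toE //; case: (leqP j p) => // jp.
  by have := lt_fz (leq_ltn_trans jp pf); rewrite -lt0n.
by rewrite ltnNge; apply/negP => fp; have := h (fz u); rewrite fz_zero ones_toE // fp.
Qed.

Lemma lt_val_fz p u : (p < fz u) -> (p < n).
Proof. by move=> pf; have := ltn_ord (fz u); lia. Qed.

Lemma entry1_fz p u : entry u p = 1 -> (p < fz u).
Proof. by move=> u1; rewrite ltnNge; apply/negP => /ge_fz. Qed.

(** Semidistributivity makes the label the least element with the given join, so antisymmetry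
    identifies it with [c]. *)
Lemma labelE a c : (a <= a `|` c)%O ->
  (forall x : triword n, a `|` x = a `|` c -> c <= x)%O ->
  label a (a `|` c)%O = c.
Proof.
move=> ab cmin; have [jl lmin] := labelP (@hoch_join_semidistributive n) ab.
by apply/le_anti; rewrite cmin // lmin.
Qed.

Lemma label_two_at u i : (0 < i < n) -> entry u i <> 2 ->
  label u (u `|` two_at i)%O = two_at i.
Proof.
move=> iD ui; apply: labelE => [|x /(entry_eq i)]; first exact: leUl.
rewrite !entry_join two_atE // eqxx two_at_le //.
by have [u2 _ _ _] := entry_wf u; have := u2 i; have [x2 _ _ _] := entry_wf x;
  have := x2 i; lia.
Qed.

(** Since [u] has 0 at [p], any [x] with the same join has 1 at [p]; by (T3) it then has no zero up
    to [p]. *)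
Lemma label_ones_to u p : (p < n) -> entry u p = 0 ->
  label u (u `|` ones_to p)%O = ones_to p.
Proof.
move=> pn up; apply: labelE => [|x /(entry_eq p)]; first exact: leUl.
rewrite !entry_join ones_toE // up leqnn ones_to_le // !max0n.
exact: entry1_fz.
Qed.

Lemma cover_join u v w : covers u v -> (w <= v)%O -> ~~ (w <= u)%O -> (u `|` w)%O = v.
Proof.
case/andP=> uv /forallP umax wv wu; apply/eqP.
have := umax (u `|` w)%O; apply: contraR => ne.
rewrite lt_neqAle leUl andbT lt_neqAle ne leUx wv (ltW uv) !andbT /=.
by apply/eqP => E; move: wu; rewrite E leUr.
Qed.

Variant label_spec u v : triword n -> Prop :=
| LabelTwo i of (0 < i < n) & entry v i = 2 & entry u i <> 2
    & (u `|` two_at i)%O = v : label_spec u v (two_at i)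
| LabelOne p of (p < n) & entry v p = 1 & entry u p = 0
    & (u `|` ones_to p)%O = v : label_spec u v (ones_to p).

Lemma entry_range u i : entry u i <> 0 -> (i < n).
Proof. by have [_ _ _ un] := entry_wf u; case: ltnP => // /un. Qed.

Lemma entry2_range u i : entry u i = 2 -> (0 < i < n).
Proof.
move=> ui; rewrite lt0n (@entry_range u) ?ui // andbT; apply/eqP => i0.
by have [_ u0 _ _] := entry_wf u; rewrite i0 in ui.
Qed.

(** Some entry [k] increases strictly. If it reaches 2, joining [two_at k] to [u] already gives [v];
    otherwise it goes from 0 to 1 and [ones_to k] does the same. *)
Lemma coverP u v : covers u v -> label_spec u v (label u v).
Proof.
move=> cuv; have /andP[uv _] := cuv.
have fromA (k : 'I_n) : entry v k = 2 -> entry u k <> 2 -> label_spec u v (label u v).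
  move=> vk uk; have kD := entry2_range vk.
  have E : (u `|` two_at k)%O = v.
    by apply: cover_join => //; rewrite two_at_le // ?vk //; apply/eqP.
  by rewrite -{2}E label_two_at //; apply: LabelTwo.
have /forallPn[k] : ~~ [forall k, v k <= u k].
  by apply/negP => vu; have := lt_geF uv => /negP[].
rewrite -!entry_ord -ltnNge => uk.
have [v2 _ _ _] := entry_wf v.
have [vk|vk] := eqVneq (entry v k) 2; first by apply: (fromA k); lia.
have v1 : entry v k = 1 by have := v2 k; lia.
have u0 : entry u k = 0 by lia.
have E : (u `|` ones_to k)%O = v.
  apply: cover_join => //; first by rewrite ones_to_le //; apply: entry1_fz.
  by rewrite ones_to_le //; apply/negP => /lt_fz; rewrite u0.
by rewrite -{2}E label_ones_to //; apply: LabelOne.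
Qed.

(* Removing [i] from the set of 2s while keeping the first zero lowers the entry
   to 1 before the first zero and to 0 after it. *)
Lemma ex_cover_two u i : entry u i = 2 ->
  exists z, [/\ covers z u, label z u = two_at i & (entry z i < 2)].
Proof.
move=> ui; have iD := entry2_range ui.
pose i' : 'I_n.+1 := inord i.
have i'E : i' = i :> nat by rewrite inordK //; lia.
have SD : twos u :\ i' \subset inner n by apply: subset_trans (subsetDl _ _) (twos_inner u).
have fS : fz u \notin twos u :\ i' by rewrite !inE fz_zero andbF.
pose x := tri (twos u :\ i') (fz u).
have xE (j : 'I_n.+1) : j != i' -> entry x j = entry u j.
  by move=> ji; rewrite tri_val_ord // entryE in_setD1 ji.
have xi : (entry x i < 2).
  by rewrite -i'E tri_val_ord // !inE eqxx /=; case: (i' < fz u).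
have [_ _ _ xn] := entry_wf x; have [_ _ _ un] := entry_wf u.
have xu : (x `|` two_at i)%O = u.
  apply: entry_inj => j; rewrite entry_join two_atE //.
  case: eqP => [->|ji]; first by rewrite ui; lia.
  rewrite maxn0; have [nj|jn] := leqP n j; first by rewrite xn ?un.
  have jn1 : (j < n.+1) by lia.
  by rewrite -[j]/(val (Ordinal jn1)) xE // -(inj_eq val_inj) /= i'E; apply/eqP.
have lt_xu : (x < u)%O.
  rewrite lt_neqAle -{2}xu leUl andbT; apply/eqP => E.
  by rewrite E ui in xi.
(* A lower cover above [x] has the same join with [two_at i], so it need not be checked that [u]
   covers [x] itself. *)
have [z xz zu] := ex_lower_cover lt_xu; have /andP[ltzu _] := zu.
have zE : (z `|` two_at i)%O = u.
  apply/le_anti; rewrite -{2}xu leU2 // leUx (ltW ltzu) /=.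
  by rewrite two_at_le // ui.
have zi : entry z i <> 2.
  by move/eqP; rewrite -two_at_le // => /join_idPl E; rewrite -zE E ltxx in ltzu.
exists z; split=> //; first by rewrite -{1}zE label_two_at.
by have [z2 _ _ _] := entry_wf z; have := z2 i; lia.
Qed.

(** Here [p] carries the last 1. Moving the first zero down to [p] changes only that entry, because
    all positions between [p] and [fz u] carry 2s. *)
Lemma ex_cover_one u p : entry u p = 1 -> filled (twos u) p.+1 (fz u) ->
  exists z, [/\ covers z u, label z u = ones_to p & entry z p = 0].
Proof.
move=> up /filledP pF; have pf := entry1_fz up; have pn := lt_val_fz pf.
pose p' : 'I_n.+1 := inord p.
have p'E : p' = p :> nat by rewrite inordK //; lia.
have pS : p' \notin twos u by rewrite inE p'E up.
pose x := tri (twos u) p'.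
have xj (j : 'I_n.+1) : entry x j = if j \in twos u then 2 else (j < p).
  by rewrite tri_val_ord ?twos_inner // p'E.
have xp : entry x p = 0 by rewrite -p'E xj (negbTE pS) p'E ltnn.
have [_ _ _ xn] := entry_wf x; have [_ _ _ un] := entry_wf u.
have xu : (x `|` ones_to p)%O = u.
  apply: entry_inj => j; rewrite entry_join ones_toE //.
  have [nj|jn] := leqP n j; first by rewrite xn ?un //; lia.
  have jn1 : (j < n.+1) by lia.
  rewrite -[j]/(val (Ordinal jn1)) xj entryE.
  case: ifP => [_|jS] /=; first by case: (_ <= p).
  case: (ltngtP j p) => jp; rewrite ?max0n ?maxn0.
  - by rewrite (ltn_trans jp pf).
  - by case: ltnP => // jf; have := pF (Ordinal jn1) jp jf; rewrite jS.
  - by rewrite jp pf.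
have lt_xu : (x < u)%O.
  rewrite lt_neqAle -{2}xu leUl andbT; apply/eqP => E.
  by rewrite E up in xp.
have [z xz zu] := ex_lower_cover lt_xu; have /andP[ltzu _] := zu.
have zE : (z `|` ones_to p)%O = u.
  apply/le_anti; rewrite -{2}xu leU2 // leUx (ltW ltzu) /=.
  by rewrite ones_to_le // pf.
have zp : entry z p = 0.
  have : ~~ (p < fz z).
    by rewrite -ones_to_le //; apply/negP => /join_idPl E; rewrite -zE E ltxx in ltzu.
  rewrite -leqNgt => /ge_fz; have := entry_eq p zE.
  by rewrite entry_join ones_toE // leqnn up; lia.
exists z; split=> //; by rewrite -{1}zE label_ones_to.
Qed.

Lemma nucleus_le u z : covers z u -> (nucleus u <= z)%O.
Proof. by move=> zu; rewrite leIx2 // meets_inf ?orbT. Qed.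

Lemma cover_Psi u z : covers z u -> label z u \in Psi u.
Proof.
move=> zu; apply/imsetP; exists (z, u) => //.
by rewrite inE /= zu nucleus_le ?lexx.
Qed.

(** By (T2) position 0 does not carry a 2, so there is a largest position before the first zero that
    carries a 1. *)
Lemma ex_last_one u : (0 < fz u) ->
  exists2 p, entry u p = 1 & filled (twos u) p.+1 (fz u).
Proof.
move=> f0; have P0 : [pred k : 'I_n.+1 | (k < fz u) && (k \notin twos u)] ord0.
  by rewrite /= f0 inE; have [_ /eqP ? _ _] := entry_wf u.
case: (arg_maxnP (fun k : 'I_n.+1 => k : nat) P0) => p /andP[pf pS] pmax.
exists p; first by rewrite entryE (negbTE pS) pf.
apply/filledP => j pj jf; apply/negPn/negP => jS.
by have := pmax j; rewrite /= jf jS leqNgt pj => /(_ isT).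
Qed.

(** Lowering the last 1 of [u], at [l], forces the nucleus to vanish at [l]. If [p > l], then [u]
    has 2 at [p], another cover lowers it below 2, and (T3) rules out a 1 after the 0 at [l]. *)
Lemma nucleus_eq0 u p : (p < fz u) -> filled (twos u) p.+1 (fz u) ->
  entry (nucleus u) p = 0.
Proof.
move=> pf /filledP pF; have f0 : (0 < fz u) by lia.
have [l ul lF] := ex_last_one f0.
have [z [zu _ zl]] := ex_cover_one ul lF; move/filledP in lF.
have /entry_le/(_ l) := nucleus_le zu; rewrite zl leqn0 => /eqP nl.
have lp : (l <= p).
  rewrite leqNgt; apply/negP => pl; have lf := entry1_fz ul.
  have ln : (l < n.+1) by have := ltn_ord (fz u); lia.
  by have := pF (Ordinal ln) pl lf; rewrite inE ul.
move: lp; rewrite leq_eqVlt => /orP[/eqP <- //|lp].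
have [n2 _ n3 _] := entry_wf (nucleus u); have := n3 _ _ lp nl.
suff : (entry (nucleus u) p < 2) by lia.
have up : entry u p = 2.
  have pn : (p < n.+1) by have := lt_val_fz pf; lia.
  by have := lF (Ordinal pn) lp pf; rewrite inE => /eqP.
have [y [yu _ yp]] := ex_cover_two up.
by apply: leq_ltn_trans yp; have /entry_le := nucleus_le yu; apply.
Qed.

Lemma two_at_ones_to i p : (0 < i < n) -> (p < n) -> two_at i <> ones_to p.
Proof.
move=> iD pn /(entry_eq i); rewrite two_atE // ones_toE // eqxx.
by case: (i <= p).
Qed.

Lemma two_at_inj i j : (0 < i < n) -> (0 < j < n) -> two_at i = two_at j -> i = j.
Proof.
move=> iD jD /(entry_eq i); rewrite !two_atE // eqxx.
by case: eqP.
Qed.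

Lemma ones_to_inj p q : (p < n) -> (q < n) -> ones_to p = ones_to q -> p = q.
Proof.
move=> pn qn E; have := entry_eq p E; have := entry_eq q E.
by rewrite !ones_toE // !leqnn; lia.
Qed.

Variant Psi_spec u : triword n -> Prop :=
| PsiTwo i of entry u i = 2 : Psi_spec u (two_at i)
| PsiOne p of (p < fz u) & filled (twos u) p.+1 (fz u) : Psi_spec u (ones_to p).

Lemma two_at_Psi u i : entry u i = 2 -> two_at i \in Psi u.
Proof. by move=> /ex_cover_two[z [zu <- _]]; apply: cover_Psi. Qed.

(** The nucleus lies strictly below [ones_to p], so some lower cover of [ones_to p] lies in the core
    interval; its label is [ones_to p] itself. *)
Lemma ones_to_Psi u p : (p < fz u) -> filled (twos u) p.+1 (fz u) ->
  ones_to p \in Psi u.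
Proof.
move=> pf pF; have pn := lt_val_fz pf; have np := nucleus_eq0 pf pF.
have nlt : (nucleus u < ones_to p)%O.
  rewrite lt_neqAle; apply/andP; split.
    by apply/eqP => /(entry_eq p); rewrite np ones_toE // leqnn.
  (* Every 2 of [u] can be lowered, so the nucleus contains no 2. After position [p], where it
     vanishes, (T3) leaves only zeros. *)
  apply/entry_le => j; rewrite ones_toE //; case: (leqP j p) => jp.
    rewrite leqNgt; apply/negP => /= nj.
    have [n2 _ _ _] := entry_wf (nucleus u).
    have nj2 : entry (nucleus u) j = 2 by have := n2 j; lia.
    have uj : entry u j = 2.
      have [u2 _ _ _] := entry_wf u; have := u2 j.
      have /entry_le/(_ j) : (nucleus u <= u)%O by apply: leIl.
      by rewrite nj2; lia.
    have [z [zu _ zj]] := ex_cover_two uj.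
    by have /entry_le/(_ j) := nucleus_le zu; lia.
  have [jf|fj] := ltnP j (fz u).
    have /filledP pF' := pF; rewrite nucleus_eq0 //.
    by apply/filledP => k jk; apply: pF'; apply: ltn_trans jk.
  rewrite leqn0; have [_ _ n3 _] := entry_wf (nucleus u).
  have nj1 := n3 _ _ jp np.
  have [n2 _ _ _] := entry_wf (nucleus u); have := n2 j.
  have [u2 _ _ _] := entry_wf u; have := u2 j.
  have /entry_le/(_ j) : (nucleus u <= u)%O by apply: leIl.
  case: (eqVneq (entry u j) 2) => [uj|]; last by have := ge_fz fj; lia.
  have [z [zu _ zj]] := ex_cover_two uj.
  by have /entry_le/(_ j) := nucleus_le zu; lia.
have [z nz cz] := ex_lower_cover nlt; have /andP[zlt _] := cz.
have pu : (ones_to p <= u)%O by rewrite ones_to_le.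
apply/imsetP; exists (z, ones_to p); first by rewrite inE /= nz cz pu.
(* A label [ones_to q] with [q < p] would leave a 1 at [p] in [z], putting [z] above [ones_to p]. *)
case: (coverP cz) => [i iD|q qn].
  by rewrite ones_toE //; case: (i <= p).
rewrite ones_toE // => qp zq zE; case: (leqP p q) => pq.
  by congr ones_to; case: (leqP q p) qp => // qp _; lia.
move/(entry_eq p): zE; rewrite entry_join !ones_toE // leqnn leqNgt pq.
rewrite maxn0 => zp; move/lt_geF: zlt; rewrite ones_to_le //.
by move/negbT/negP; case; apply: entry1_fz.
Qed.

(** A label [two_at i] needs a 2 in the top of its cover, hence in [u]. A label [ones_to p] needs
    the nucleus to vanish at [p], which fails if some 1 of [u] lies between [p] and the first
    zero. *)
Lemma PsiP u c : c \in Psi u -> Psi_spec u c.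
Proof.
case/imsetP => -[x y] /=; rewrite inE /= => /and3P[nx cxy yu ->].
have [u2 _ _ _] := entry_wf u; move/entry_le in yu.
case: (coverP cxy) => [i iD yi _ _|p pn yp xp _].
  by apply: PsiTwo; have := yu i; have := u2 i; lia.
have pf : (p < fz u).
  rewrite -ones_to_le // (le_trans (y := y)) ?ones_to_le //; first exact: entry1_fz.
  exact/entry_le.
apply: PsiOne => //; apply/filledP => j pj jf; apply/negPn/negP => jS.
have uj : entry u j = 1 by rewrite entryE (negbTE jS) jf.
suff /entry_le/(_ p) : (ones_to p <= nucleus u)%O.
  move/entry_le/(_ p) in nx; rewrite ones_toE // leqnn.
  by move: nx; rewrite /= xp; lia.
rewrite lexI ones_to_le // pf /=; apply/meetsP => z zu.
rewrite ones_to_le // ltnNge; apply/negP => fzp.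
(* If [z] is not above [ones_to p], this join lies strictly between [z] and [u]: its entry at
   [j > p] is that of [z], which is not 1 by (T3), while [u] has 1 there. *)
have /andP[ltzu /forallP/(_ (z `|` ones_to p)%O)/negP] := zu; apply.
have le_pu : (ones_to p <= u)%O by rewrite ones_to_le.
rewrite !lt_neqAle leUl leUx (ltW ltzu) le_pu !andbT.
apply/andP; split; apply/eqP => E.
  have : (ones_to p <= z)%O by rewrite E leUr.
  by rewrite ones_to_le // ltnNge fzp.
have := entry_eq j E; rewrite entry_join ones_toE // uj.
rewrite leqNgt pj maxn0; apply: ge_fz; lia.
Qed.

Lemma two_at_PsiE u i : (0 < i < n) -> (two_at i \in Psi u) = (entry u i == 2).
Proof.
move=> iD; apply/idP/eqP => [/PsiP|/two_at_Psi //].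
move E: (two_at i) => c h; case: h E => [k uk|p pf _].
  by move/two_at_inj => -> //; apply: entry2_range uk.
by move/two_at_ones_to => []//; apply: lt_val_fz pf.
Qed.

Lemma ones_to_PsiE u p : (p < n) ->
  (ones_to p \in Psi u) = (p < fz u) && filled (twos u) p.+1 (fz u).
Proof.
move=> pn; apply/idP/andP => [/PsiP|[]]; last exact: ones_to_Psi.
move E: (ones_to p) => c h; case: h E => [k uk|q qf qF].
  by move/esym/two_at_ones_to => []//; apply: entry2_range uk.
by move/ones_to_inj => -> //; apply: lt_val_fz qf.
Qed.

Lemma clo_leE (u v : clo (triword n)) :
  (u <= v)%O = (twos u \subset twos v) &&
     ((fz u == 0 :> nat) || (fz u \in fz v |: run (twos v) (fz v))).
Proof.
rewrite in_cap; apply/subsetP/andP => [h|[/subsetP sub Hf] c /PsiP[i ui|p pf pF]].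
- have sub : twos u \subset twos v.
    apply/subsetP => i; rewrite !inE => /eqP ui.
    by rewrite -two_at_PsiE ?(entry2_range ui) //; apply/h/two_at_Psi.
  split=> //; case: eqP => //= /eqP; rewrite -lt0n => f0.
  (* The label at the position just before the first zero is always in [Psi u], its run condition
     being vacuous; its membership in [Psi v] is the condition on [fz u]. *)
  have pf : ((fz u).-1 < fz u) by rewrite prednK.
  have pn := lt_val_fz pf.
  have /h : ones_to (fz u).-1 \in Psi u.
    by apply: ones_to_Psi => //; rewrite prednK //; apply/filledP => j; lia.
  by rewrite ones_to_PsiE // prednK.
- apply: two_at_Psi; have iD := entry2_range ui.
  have lin : (i < n.+1) by lia.
  by have := sub (Ordinal lin); rewrite !inE ui => /(_ isT)/eqP.
have pn := lt_val_fz pf; rewrite ones_to_PsiE //.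
move: Hf; rewrite gtn_eqF ?(leq_ltn_trans _ pf) //= => /andP[fuv /filledP vF].
rewrite (leq_trans pf) //; apply/filledP => j pj jf; move/filledP in pF.
by case: (leqP (fz u) j) => [uj|ju]; [apply: vF|apply/sub/pF].
Qed.

Lemma mem_Can u c : c \in Can u -> exists2 z, covers z u & c = label z u.
Proof. by case/imsetP => z; rewrite inE => zu ->; exists z. Qed.

(** Canonical joinands are core labels, which gives their shape and the run condition. The cover
    moreover ends with a 1 at [p], so [p] is the position of the last 1. *)
Lemma CanE u : Can u =
  [set two_at i | i : 'I_n.+1 in twos u] :|:
  [set ones_to p | p : 'I_n.+1 & (entry u p == 1) && filled (twos u) p.+1 (fz u)].
Proof.
apply/setP => c; rewrite inE; apply/idP/orP.
  case/mem_Can => z zu cE; have := PsiP (cover_Psi zu); rewrite -cE => cP.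
  case: cP cE => [i ui _|p pf pF].
    left; have iD := entry2_range ui; have lin : (i < n.+1) by lia.
    by apply/imsetP; exists (Ordinal lin); rewrite // inE ui.
  move=> cE; right; have pn := lt_val_fz pf; have lpn : (p < n.+1) by lia.
  apply/imsetP; exists (Ordinal lpn) => //; rewrite inE pF andbT /=.
  move E: (ones_to p) cE => d cE; move: E; rewrite cE.
  case: (coverP zu) => [i iD _ _ _|q qn uq _ _].
    by move/esym/two_at_ones_to => [].
  by move/ones_to_inj => -> //; rewrite uq.
case=> /imsetP[k].
  by rewrite inE => /eqP/ex_cover_two[z [zu <- _]] ->; apply/imsetP; exists z; rewrite ?inE.
rewrite inE => /andP[/eqP up pF] ->; have [z [zu <- _]] := ex_cover_one up pF.
by apply/imsetP; exists z; rewrite ?inE.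
Qed.

End CoreLabels.

(** * Canonical joinands, atoms and the rank function *)

Section Statistics.
Context (n : nat).
Local Notation two_at := (two_at n).
Local Notation ones_to := (ones_to n).
Implicit Types (u v w z : triword n) (S : {set 'I_n.+1}) (f : 'I_n.+1).

(** Holds at most one position, that of the last 1; the set form matches [CanE]. *)
Definition last_ones u : {set 'I_n.+1} :=
  [set p : 'I_n.+1 | (entry u p == 1) && filled (twos u) p.+1 (fz u)].

Lemma card_labels S (T : {set 'I_n.+1}) : S \subset inner n ->
  {in T, forall p : 'I_n.+1, p < n} ->
  #|[set two_at i | i : 'I_n.+1 in S] :|: [set ones_to p | p : 'I_n.+1 in T]|
  = #|S| + #|T|.
Proof.
move=> /subsetP SD Tn; have Sn i : i \in S -> 0 < i < n by move/SD; rewrite inE.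
rewrite cardsU !card_in_imset.
- rewrite (_ : _ :&: _ = set0) ?cards0 ?subn0 //; apply/setP => c; rewrite !inE.
  apply/negP => /andP[/imsetP[i /Sn iD ->] /imsetP[p /Tn pn]].
  exact: two_at_ones_to.
- by move=> p q /Tn pn /Tn qn /ones_to_inj E; apply: val_inj; apply: E.
- by move=> i j /Sn iD /Sn jD /two_at_inj E; apply: val_inj; apply: E.
Qed.

Lemma last_ones_lt u : {in last_ones u, forall p : 'I_n.+1, p < n}.
Proof. by move=> p; rewrite inE => /andP[/eqP/entry1_fz/lt_val_fz]. Qed.

Lemma card_last_ones u : #|last_ones u| = (0 < fz u).
Proof.
case: (posnP (fz u)) => [f0|f0].
  apply/eqP; rewrite cards_eq0; apply/eqP/setP => p; rewrite !inE.
  by apply/negP => /andP[/eqP/entry1_fz]; rewrite f0.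
have [p up pF] := ex_last_one f0; have pn := lt_val_fz (entry1_fz up).
have lpn : p < n.+1 by lia.
apply/eqP/cards1P; exists (Ordinal lpn); apply/setP => q; rewrite !inE.
apply/andP/eqP => [[/eqP uq qF]|->]; last by rewrite up.
apply: val_inj => /=; case: (ltngtP q p) => // h.
  move/filledP/(_ (Ordinal lpn) h (entry1_fz up)): qF.
  by rewrite inE /= up.
by move/filledP/(_ q h (entry1_fz uq)): pF; rewrite inE uq.
Qed.

Lemma card_Can u : #|Can u| = #|twos u| + (0 < fz u).
Proof. by rewrite CanE card_labels ?card_last_ones ?twos_inner //; apply: last_ones_lt. Qed.

Lemma two_at_atom i : 0 < i < n -> two_at i \in atoms (triword n).
Proof.
move=> iD; rewrite inE /covers; apply/andP; split.
  rewrite lt_neqAle le0x andbT; apply/eqP => /(entry_eq i).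
  by rewrite entry_bot two_atE // eqxx.
apply/forallP => z; apply/negP => /andP[z0 zi].
have /entry_le zi' := ltW zi.
suff z00 : z = \bot%O by rewrite z00 ltxx in z0.
apply: entry_inj => j; rewrite entry_bot; have := zi' j; rewrite two_atE //.
case: eqP => [->|_]; last by lia.
have [z2 _ z3 _] := entry_wf z.
(* As [i > 0], the word [z] starts with 0, so (T3) excludes a 1 at [i]. *)
have z0' : entry z 0 = 0 by have := zi' 0; rewrite two_atE //; case: eqP; lia.
have := z3 0 i; have : entry z i <> 2; last by lia.
by move/eqP; rewrite -two_at_le // => /(lt_le_trans zi); rewrite ltxx.
Qed.

Lemma ones_to_atom p : p < n -> (ones_to p \in atoms (triword n)) = (p == 0).
Proof.
move=> pn; have gt_bot q : q < n -> (\bot < ones_to q)%O.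
  move=> qn; rewrite lt_neqAle le0x andbT; apply/eqP => /(entry_eq q).
  by rewrite entry_bot ones_toE // leqnn.
have n0 : 0 < n by apply: leq_ltn_trans pn.
rewrite inE /covers gt_bot //=; apply/forallP/eqP => [/(_ (ones_to 0))|-> z].
  rewrite gt_bot //= => h; apply: contraNeq h => p0.
  rewrite lt_neqAle; apply/andP; split.
    by apply/eqP => /ones_to_inj E; rewrite -E ?eqxx in p0.
  by apply/entry_le => j; rewrite !ones_toE //; lia.
apply/negP => /andP[z0 z1]; have /entry_le z1' := ltW z1.
suff z00 : z = \bot%O by rewrite z00 ltxx in z0.
have zz : entry z 0 = 0.
  apply/eqP; rewrite -leqn0 leqNgt; apply/negP => h.
  have : (ones_to 0 <= z)%O.
    rewrite ones_to_le // ltnNge; apply/negP; rewrite leqn0 => /eqP fz0.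
    by move: h; rewrite -fz0 fz_zero.
  by move/(lt_le_trans z1); rewrite ltxx.
apply: entry_inj => j; rewrite entry_bot.
by case: j => [//|j]; have := z1' j.+1; rewrite ones_toE // ltn0 leqn0 => /eqP.
Qed.

Lemma entry0 u : (entry u 0 == 1) = (0 < fz u).
Proof.
rewrite -[0]/(nat_of_ord (@ord0 n)) entryE ifF; first by case: (_ < _).
by apply/negbTE; rewrite inE; have [_ /eqP] := entry_wf u.
Qed.

(** Every [two_at i] is an atom, but [ones_to p] only for [p = 0]. The last 1 sits at position 0
    exactly when all later positions before the first zero carry 2s. *)
Lemma negE u : neg u = #|twos u| + ((0 < fz u) && filled (twos u) 1 (fz u)).
Proof.
pose T := [set p in last_ones u | p == ord0].
have Tn : {in T, forall p : 'I_n.+1, p < n}.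
  by move=> p /setIdP[/last_ones_lt].
have -> : #|twos u| + ((0 < fz u) && filled (twos u) 1 (fz u)) = #|twos u| + #|T|.
  congr (_ + _); have -> : T = if ord0 \in last_ones u then [set ord0] else set0.
    apply/setP => p; rewrite in_set; case: ifP => h.
      by rewrite in_set1; case: eqP => [->|_]; rewrite ?h ?andbF.
    by rewrite in_set0; apply/negP => /andP[+ /eqP E]; rewrite E h.
  by rewrite inE entry0; case: ifP; rewrite ?cards1 ?cards0.
rewrite -card_labels ?twos_inner //; congr #|pred_of_set _|; rewrite CanE setIUl.
congr (_ :|: _); apply/setP => c; rewrite inE.
  apply/andb_idr => /imsetP[i iS ->]; apply: two_at_atom.
  by have /subsetP/(_ i iS) := twos_inner u; rewrite inE.
apply/andP/imsetP => [[/imsetP[p pL ->]]|[p /setIdP[pL /eqP p0] ->]].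
  rewrite ones_to_atom ?(last_ones_lt pL) // => p0; exists p => //.
  by rewrite inE pL; apply/eqP/val_inj/eqP.
rewrite ones_to_atom ?(last_ones_lt pL) // p0; split=> //.
by apply/imsetP; exists ord0; rewrite // -p0.
Qed.

(** This yields gradedness, since for a cover it forces [w = u]. Either the two sets of 2s agree and
    only the first zero moves, or some 2 of [v] missing from [u] is removed. *)
Lemma clo_pred (u v : clo (triword n)) : (u < v)%O ->
  exists w : clo (triword n), [/\ (u <= w)%O, (w < v)%O & #|Can v| = #|Can w|.+1].
Proof.
move=> ltuv; have := ltW ltuv; rewrite clo_leE => /andP[sub Hf].
have [ST|] := eqVneq (twos u) (twos v).
  exists u; rewrite lexx ltuv !card_Can ST; split=> //.
  have fN : fz u <> fz v.
    by move=> E; move: ltuv; rewrite (triword_eq ST E : u = v) ltxx.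
  have := fz_twos u; rewrite ST => fS.
  (* A nonzero [fz u] other than [fz v] would lie in a run of [twos v], but it is not in
     [twos u = twos v]. *)
  have u0 : fz u = 0 :> nat.
    case/orP: Hf => [/eqP //|/setU1P[//|/(subsetP (run_sub _ _))]].
    by rewrite (negbTE fS).
  have v0 : fz v <> 0 :> nat by move=> v0; apply/fN/val_inj; rewrite /= u0 v0.
  by rewrite u0 lt0n (introF eqP v0) addn0 addn1.
rewrite eqEsubset sub /= => /subsetPn[s sv su].
pose S := twos v :\ s.
have SD : S \subset inner n by apply: subset_trans (subsetDl _ _) (twos_inner v).
have uS : twos u \subset S by rewrite subsetD1 sub.
have cS : #|twos v| = #|S|.+1 by rewrite (cardsD1 s) sv.
have wN f : f \notin S -> (tri S f : clo (triword n)) != v.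
  move=> fS; apply/eqP => E; have := congr1 (@twos n) E.
  by rewrite twos_tri // => E2; move: sv; rewrite -E2 !inE eqxx.
have vS : fz v \notin S by rewrite !inE fz_zero andbF.
have sS : s \notin S by rewrite !inE eqxx.
(* The first zero of [v] can be kept unless removing [s] breaks the run from [fz u] to [fz v]. *)
have [h|h] := boolP ((fz u == 0 :> nat) || (fz u \in fz v |: run S (fz v))).
  exists (tri S (fz v)); rewrite lt_neqAle wN // !clo_leE.
  rewrite !twos_tri // !fz_tri // uS h !card_Can twos_tri // fz_tri // cS.
  by rewrite subsetDl setU11 orbT.
move: h Hf; rewrite negb_or; case: eqP => //= u0.
rewrite !in_cap negb_and => h /andP[fuv vF]; move: h; rewrite fuv /=.
move/forallPn => [j]; rewrite negb_imply => /andP[/andP[uj jv]].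
have jv2 : j \in twos v by move/filledP: vF; apply.
rewrite in_setD1 jv2 andbT negbK => /eqP js.
rewrite {j}js in uj jv jv2.
have s0 : 0 < s by have /subsetP/(_ s sv) := twos_inner v; rewrite inE => /andP[].
have v0 : 0 < fz v by apply: ltn_trans jv.
(* Now [s] lies in that run. With first zero [s], the run from [fz u] to [s] avoids [s], and the run
   from [s] to [fz v] is only needed in [twos v]. *)
exists (tri S s); rewrite lt_neqAle wN // !clo_leE.
rewrite !twos_tri // !fz_tri // uS !card_Can twos_tri // fz_tri // cS s0 v0.
rewrite subsetDl !in_cap (ltnW jv) uj; split=> //.
  rewrite /= orbC; apply/orP; left; apply/filledP => j uj' js.
  rewrite in_setD1; have -> : j \in twos v.
    by move/filledP: vF; apply => //; apply: ltn_trans jv.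
  by rewrite andbT; apply/eqP => E; rewrite E ltnn in js.
rewrite /= orbC; apply/orP; left; apply/filledP => j sj jf.
by move/filledP: vF; apply => //; apply: leq_trans sj.
Qed.

Lemma clo_rank (u : clo (triword n)) : rank u = #|Can (u : triword n)|.
Proof.
symmetry; apply: (@rankP _ _ (fun u : clo (triword n) => #|Can (u : triword n)|)).
split=> [v vmin|v w /andP[vw /forallP vmax]].
  case: (posnP #|Can (v : triword n)|) => // cv.
  pose o : clo (triword n) := tri set0 ord0.
  have o2 : twos o = set0 by rewrite twos_tri ?sub0set ?inE.
  have of0 : fz o = ord0 by rewrite fz_tri ?sub0set ?inE.
  have ov : (o <= v)%O by rewrite clo_leE o2 of0 sub0set.
  have := vmin o; rewrite lt_neqAle ov andbT negbK => /eqP E.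
  by rewrite -E card_Can o2 of0 cards0 in cv.
have [z [vz zw ->]] := clo_pred vw.
have := vmax z; rewrite zw andbT lt_neqAle vz andbT negbK => /eqP E.
by rewrite -E.
Qed.

End Statistics.

(** * Evaluation of both sides of the identity *)

Section FTriangle.
Local Open Scope ring_scope.

(** The first zero 0 is always admissible and gets its own term: it is outside
    [fz v |: run (twos v) (fz v)] when [fz v > 0], and the only choice when [fz v = 0]. *)
Lemma sum_clo_below (n : nat) (V : nmodType) (v : clo (triword n))
    (F : {set 'I_n.+1} -> 'I_n.+1 -> V) :
  \sum_(u : clo (triword n) | (u <= v)%O) F (twos u) (fz u) =
  \sum_(S : {set 'I_n.+1} | S \subset twos v)
     (F S ord0 + if (0 < fz v)%N
       then \sum_(f in (fz v |: run (twos v) (fz v)) :\: S) F S f else 0).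
Proof.
rewrite sum_triword big_mkcond [RHS]big_mkcond; apply: eq_bigr => S _.
case: (boolP (S \subset inner n)) => SD; last first.
  by case: ifP => // /subset_trans/(_ (twos_inner v)); rewrite (negbTE SD).
have S0 : ord0 \notin S by apply/negP => /(subsetP SD); rewrite inE.
transitivity (\sum_(f : 'I_n.+1 | (f \notin S) && ((S \subset twos v) &&
    ((f == ord0) || (f \in fz v |: run (twos v) (fz v))))) F S f).
  apply: eq_big => [f|f /andP[fS _]]; last by rewrite twos_tri ?fz_tri.
  by case: (boolP (f \in S)) => //= fS; rewrite clo_leE twos_tri ?fz_tri.
case: ifP => Sv; last by rewrite big1 // => f /andP[].
rewrite (bigD1 ord0) ?S0 ?eqxx //=; congr (_ + _).
have v0 : ord0 \notin twos v by apply/negP => /(subsetP (twos_inner v)); rewrite inE.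
case: ifP => f0.
  apply: eq_bigl => f; rewrite in_setD; case: eqP => [->|_] /=; last first.
    by rewrite andbT.
  rewrite andbF in_setU1 -(inj_eq val_inj) /= ltn_eqF //=.
  by apply/esym/negbTE; rewrite negb_and (contra (subsetP (run_sub _ _) _)) ?orbT.
rewrite big1 // => f /andP[/andP[fS /orP[->//|]]].
rewrite in_cap => /andP[+ _]; rewrite leqNgt in f0 *.
by move=> h /negP[]; apply/eqP/val_inj => /=; lia.
Qed.

Lemma sum_gaps (n : nat) (K : pzRingType) (S D : {set 'I_n.+1}) (e : 'I_n.+1) (a b : K) :
  S \subset D -> e \notin S ->
  \sum_(f in (e |: run D e) :\: S) (a - #|run S f|%:R * b)
  = a * #|run D e :\: S|.+1%:R - #|run D e :&: S|%:R * b.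
Proof.
move=> SD eS; rewrite sumrB sumr_const card_cap_diff // mulr_natr; congr (_ - _).
by rewrite -mulr_suml -natr_sum sum_run.
Qed.

(** For [fz v = 0] this is the binomial theorem. Otherwise summing over the gaps adds to each [S] a
    part linear in the elements of [run (twos v) (fz v)]. *)
Lemma sum_clo_signed (n : nat) (K : comPzRingType) (T : K) (v : clo (triword n)) :
  (1 + T) ^+ #|Can (v : triword n)| =
  \sum_(u : clo (triword n) | (u <= v)%O)
     T ^+ #|twos u| * (if fz u == ord0 then 1 else T - #|run (twos u) (fz u)|%:R).
Proof.
rewrite (sum_clo_below v
  (fun S f => T ^+ #|S| * (if f == ord0 then 1 else T - #|run S f|%:R))) card_Can.
have v0 : ord0 \notin twos v by apply/negP => /(subsetP (twos_inner v)); rewrite inE.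
have wtE S : wt (twos v) T 1 S = T ^+ #|S| by rewrite /wt expr1n mulr1.
case f0: (0 < fz v)%N; last first.
  rewrite addn0 addrC -(sum_wt (twos v) T 1); apply: eq_bigr => S _.
  by rewrite eqxx mulr1 addr0 wtE.
(* The linear part sums to 0: an element of the run counts -1 with weight [T] if it is in [S], and
   [T] with weight 1 if it is not. *)
transitivity (\sum_(S : {set 'I_n.+1} | S \subset twos v) wt (twos v) T 1 S * (1 + T) +
  \sum_(S : {set 'I_n.+1} | S \subset twos v) wt (twos v) T 1 S *
    ((-1) * #|run (twos v) (fz v) :&: S|%:R + T * #|run (twos v) (fz v) :\: S|%:R)).
  rewrite sum_wt_card ?run_sub // -mulr_suml sum_wt addn1 exprSr.
  by rewrite mulrN1 mul1r addNr mul0r mulr0 addr0 [T + 1]addrC.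
rewrite -big_split /=; apply: eq_bigr => S Sv; rewrite wtE -mulrDr mulr1.
have vS : fz v \notin S by apply/negP => /(subsetP Sv); rewrite inE fz_zero.
transitivity (T ^+ #|S| * (1 +
    \sum_(f in (fz v |: run (twos v) (fz v)) :\: S) (T - #|run S f|%:R * 1))).
  by rewrite sum_gaps // -natr1; ring.
rewrite mulrDr mulr1 mulr_sumr; congr (_ + _); apply: eq_bigr => f.
rewrite in_setD mulr1 in_cap => /andP[_ /andP[_ /filledP fF]].
by case: eqP fF v0 => // -> /(_ ord0 (leqnn _) f0) ->.
Qed.

Lemma M_triangleE (n : nat) (K : comPzRingType) (X Y : K) :
  M_triangle n X Y = \sum_(v : triword n)
    Y ^+ #|Can v| * ((X - 1) ^+ #|twos v| *
      (if fz v == ord0 then 1 else X - 1 - #|run (twos v) (fz v)|%:R)).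
Proof.
rewrite /M_triangle exchange_big; apply: eq_bigr => v _.
rewrite -mulr_suml mulrC clo_rank; congr (_ * _).
rewrite -(mobius_inversion (f := fun u : clo (triword n) => X ^+ #|Can (u : triword n)|)
  (g := fun u : clo (triword n) => (X - 1) ^+ #|twos u| *
      (if fz u == ord0 then 1 else X - 1 - #|run (twos u) (fz u)|%:R))).
  by apply: eq_bigr => u _; rewrite clo_rank.
by move=> u; rewrite -sum_clo_signed subrKC.
Qed.

Section Top.
Context (N : nat) (V : nmodType).
Let n := N.+1.

Lemma max_notin_inner : ord_max \notin inner n.
Proof. by rewrite inE /= ltnn. Qed.

Lemma run_inner : run (inner n) (ord_max : 'I_n.+1) = inner n.
Proof.
apply/setP => i; apply/idP/idP => [/(subsetP (run_sub _ _)) //|iD].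
rewrite in_run; move: iD; rewrite inE => /andP[i0 lin]; rewrite lin.
by apply/filledP => j ij jn; rewrite inE (leq_trans i0 ij) jn.
Qed.

Lemma card_inner : #|inner n| = N.
Proof.
have : (#|ord_max |: (ord0 |: inner n)| = N.+2)%N.
  rewrite -[RHS](card_ord n.+1) -cardsT; congr #|pred_of_set _|.
  apply/setP => i; rewrite !inE -!(inj_eq val_inj) /=.
  by have := ltn_ord i; rewrite /n; lia.
rewrite !cardsU1 !inE -(inj_eq val_inj) /= ltnn.
by move=> [].
Qed.

(** The triword 1, 2, ..., 2 is greatest in the core label order, so the sum over its down-set
    covers all triwords. *)
Lemma sum_triword_top (F : {set 'I_n.+1} -> 'I_n.+1 -> V) :
  \sum_(u : triword n) F (twos u) (fz u) =
  \sum_(S : {set 'I_n.+1} | S \subset inner n)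
     (F S ord0 + \sum_(f in (ord_max |: inner n) :\: S) F S f).
Proof.
pose t : clo (triword n) := tri (inner n) ord_max.
have [tT fT] : twos t = inner n /\ fz t = ord_max.
  by rewrite twos_tri ?fz_tri ?max_notin_inner.
transitivity (\sum_(u : clo (triword n) | (u <= t)%O) F (twos u) (fz u)).
  apply: eq_bigl => u; apply/esym; rewrite clo_leE tT fT run_inner twos_inner /=.
  rewrite !inE -(inj_eq val_inj) /=; have := ltn_ord (fz u); rewrite /n; lia.
by rewrite sum_clo_below tT fT run_inner.
Qed.

End Top.

(** By [negE], the first gap of [S] is the only nonzero first zero for which [ones_to 0] is a
    canonical joinand. *)
Lemma sum_first_gap (N : nat) (S : {set 'I_N.+2}) :
  S \subset inner N.+1 ->
  exists2 f, f \in (ord_max |: inner N.+1) :\: S &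
    forall g, g \in (ord_max |: inner N.+1) :\: S -> filled S 1 g = (g == f).
Proof.
move=> SD; have mS : ord_max \notin S.
  by apply/negP => /(subsetP SD); rewrite (negbTE (max_notin_inner N)).
have C g : (g \in (ord_max |: inner N.+1) :\: S) = (0 < g)%N && (g \notin S).
  rewrite in_setD andbC; congr (_ && _); rewrite !inE -(inj_eq val_inj) /=.
  by have := ltn_ord g; lia.
have [f [f1 _ fS] fF] := @first_gap N.+1 S (inord 1) ord_max (leq_ord _) mS.
have i1 : (inord 1 : 'I_N.+2) = 1%N :> nat by rewrite inordK.
rewrite i1 in f1 fF; exists f => [|g]; rewrite C ?f1 // => /andP[g0 gS].
apply/idP/eqP => [gF|-> //].
by apply: (@gap_unique _ S (inord 1)); rewrite ?i1.
Qed.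

(** The common evaluation for both sides. For [N = 0] the truncated exponent [N.-1] is harmless, as
    the factor [N] kills its term. *)
Lemma sum_gap_weights (N : nat) (K : comPzRingType) (a b c d e : K) :
  \sum_(S : {set 'I_N.+2} | S \subset inner N.+1) wt (inner N.+1) a b S *
     (c + d * #|inner N.+1 :&: S|%:R + e * #|inner N.+1 :\: S|%:R)
  = c * (a + b) ^+ N + N%:R * ((a * d + b * e) * (a + b) ^+ N.-1).
Proof.
under eq_bigr => S _ do rewrite -addrA mulrDr.
by rewrite big_split /= sum_wt_card // -mulr_suml sum_wt card_inner mulrC.
Qed.

(** With [T = (x + 1) / (y - x)] and [Y = (y - x) / y], the product [T * Y] is [(x + 1) / y], so the
    power of [y] in front clears all denominators. *)
Lemma F_triangleE (K : fieldType) (N : nat) (x y : K) : y != 0 -> y - x != 0 ->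
  F_triangle N.+1 x y = (x + 1 + y) ^+ N.+1
    + N%:R * ((x + 1) * x * (x + 1 + y) ^+ N.-1).
Proof.
move=> y0 yx; rewrite /F_triangle M_triangleE.
have -> : (y + 1) / (y - x) - 1 = (x + 1) / (y - x).
  by rewrite -{2}(divff yx) -mulrBl; congr (_ / _); ring.
set T := (x + 1) / (y - x); set Y := (y - x) / y.
have TY : T * Y = (x + 1) / y by rewrite /T /Y mulrA divfK.
rewrite mulr_sumr.
under eq_bigr => u _ do rewrite card_Can.
rewrite (sum_triword_top (fun S f => y ^+ N.+1 * (Y ^+ (#|S| + (0 < f)) * (T ^+ #|S| *
  (if f == ord0 then 1 else T - #|run S f|%:R))))).
transitivity (\sum_(S : {set 'I_N.+2} | S \subset inner N.+1)
  wt (inner N.+1) (x + 1) y S * ((y + (x + 1)) + - (y - x) * #|inner N.+1 :&: S|%:R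
     + (x + 1) * #|inner N.+1 :\: S|%:R)); last first.
  (* The second coefficient is [- (x + 1) * (y - x) + y * (x + 1) = x * (x + 1)]. *)
  by rewrite sum_gap_weights exprS; congr (_ + _); [ring|congr (_ * (_ * _)); ring].
apply: eq_bigr => S SD.
have mS : ord_max \notin S.
  by apply/negP => /(subsetP SD); rewrite (negbTE (max_notin_inner N)).
have wE : y ^+ N.+1 * (Y ^+ #|S| * T ^+ #|S|) = wt (inner N.+1) (x + 1) y S * y.
  rewrite -exprMn [Y * T]mulrC TY /wt expr_div_n exprSr.
  have -> : y ^+ N = y ^+ #|S| * y ^+ #|inner N.+1 :\: S|.
    by rewrite -exprD cardsDS // subnKC ?subset_leq_card // card_inner.
  by field; rewrite expf_neq0.
rewrite ltnn addn0 eqxx mulr1 wE -[_ + _ * _]addrA -[y + _ + _]addrA mulrDr; congr (_ + _).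
(* A gap preceded by a run of length [m] contributes [y * Y * (T - m) = x + 1 - m * (y - x)]. *)
transitivity (\sum_(f in (ord_max |: run (inner N.+1) ord_max) :\: S)
   wt (inner N.+1) (x + 1) y S * (x + 1 - #|run S f|%:R * (y - x))).
  rewrite run_inner; apply: eq_bigr => f fC.
  have f0 : (0 < f)%N by move: fC; rewrite !inE; case/andP=> _ /orP[/eqP ->|/andP[]].
  have -> : (f == ord0) = false by apply/negbTE; rewrite -(inj_eq val_inj) /= -lt0n.
  rewrite f0 addn1 [Y ^+ _.+1]exprSr.
  transitivity (y ^+ N.+1 * (Y ^+ #|S| * T ^+ #|S|) * (Y * (T - #|run S f|%:R))); first ring.
  rewrite wE -mulrA; congr (_ * _); rewrite mulrBr [Y * T]mulrC TY mulrBr /Y.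
  by field.
rewrite -mulr_sumr sum_gaps // run_inner -natr1; congr (_ * _); ring.
Qed.

(** For fixed [S], the first zero 0 contributes a factor [x], the first gap [y + 1], and every other
    gap [x + 1]. *)
Lemma sum_Can_negE (K : comPzRingType) (N : nat) (x y : K) :
  \sum_(u : triword N.+1)
      x ^+ (N.+1 - #|Can u|) * (x + 1) ^+ (#|Can u| - neg u) * (y + 1) ^+ neg u
  = (x + 1 + y) ^+ N.+1 + N%:R * ((x + 1) * x * (x + 1 + y) ^+ N.-1).
Proof.
under eq_bigr => u _ do rewrite card_Can negE.
rewrite (sum_triword_top (fun S f => x ^+ (N.+1 - (#|S| + (0 < f)))
  * (x + 1) ^+ (#|S| + (0 < f) - (#|S| + ((0 < f)%N && filled S 1 f)))
  * (y + 1) ^+ (#|S| + ((0 < f)%N && filled S 1 f)))).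
transitivity (\sum_(S : {set 'I_N.+2} | S \subset inner N.+1)
  wt (inner N.+1) (y + 1) x S * (x + (y + 1) + 0 * #|inner N.+1 :&: S|%:R
     + (x + 1) * #|inner N.+1 :\: S|%:R)); last first.
  rewrite sum_gap_weights (_ : y + 1 + x = x + 1 + y); last by ring.
  by rewrite exprS; congr (_ + _); [ring|congr (_ * (_ * _)); ring].
apply: eq_bigr => S SD.
have cS : (#|S| + #|inner N.+1 :\: S| = N)%N.
  by rewrite cardsDS // subnKC ?subset_leq_card // card_inner.
have mS : ord_max \notin S.
  by apply/negP => /(subsetP SD); rewrite (negbTE (max_notin_inner N)).
have cC : #|(ord_max |: inner N.+1) :\: S| = #|inner N.+1 :\: S|.+1.
  by have := card_cap_diff (inner N.+1) mS; rewrite run_inner.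
rewrite ltnn !addn0 subnn expr0 mulr1 mul0r addr0 -[x + _ + _]addrA mulrDr.
congr (_ + _).
  rewrite /wt (_ : (N.+1 - #|S|)%N = #|inner N.+1 :\: S|.+1) ?exprS; last lia.
  ring.
have [f fC fE] := sum_first_gap SD.
transitivity (\sum_(g in (ord_max |: inner N.+1) :\: S)
   wt (inner N.+1) (y + 1) x S * (if g == f then y + 1 else x + 1)).
  apply: eq_bigr => g gC; rewrite fE //.
  have -> /= : (0 < g)%N by move: gC; rewrite !inE; case/andP=> _ /orP[/eqP ->|/andP[]].
  rewrite /wt (_ : (N.+1 - (#|S| + 1))%N = #|inner N.+1 :\: S|); last lia.
  case: eqP => _ /=; first by rewrite subnn addn1 exprS; ring.
  by rewrite addn0 addnC addnK; ring.
rewrite -mulr_sumr; congr (_ * _); rewrite (bigD1 f) //= eqxx; congr (_ + _).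
rewrite (eq_bigr (fun=> x + 1)) => [|g /andP[_ /negbTE -> //]].
rewrite sumr_const mulr_natr; congr (_ *+ _).
rewrite (cardsD1 f) fC in cC; case: cC => <-; apply: eq_card => g.
by rewrite in_setD1 unfold_in andbC.
Qed.

(** * Nonvanishing denominators and the conclusion *)

Lemma vary_neq0 : vary != 0.
Proof.
rewrite /vary tofrac_eq0; apply/eqP => /(congr1 (mcoeff (mnm1 ord_max))).
by rewrite mcoeffX eqxx mcoeff0 => /eqP; rewrite oner_eq0.
Qed.

Lemma vary_sub_varx_neq0 : vary - varx != 0.
Proof.
rewrite /vary /varx -tofracB tofrac_eq0; apply/eqP.
move/(congr1 (mcoeff (mnm1 ord_max))).
rewrite mcoeffB !mcoeffX eqxx mcoeff0 eq_mnm1.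
by move/eqP; rewrite subr0 oner_eq0.
Qed.

End FTriangle.

Local Open Scope ring_scope.

Theorem proposition6p11 (n : nat) (hn : (0 < n)%N) :
  F_triangle n varx vary =
    \sum_(u : triword n)
      varx ^+ (n - #|Can u|) * (varx + 1) ^+ (#|Can u| - neg u)
        * (vary + 1) ^+ neg u.
Proof.
case: n hn => [//|N] _.
by rewrite (F_triangleE _ vary_neq0 vary_sub_varx_neq0) sum_Can_negE.
Qed.
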